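(* Let $\mathfrak g=\mathfrak{sl}_3$. There is neither an involutive exact equivalence $F:\mathcal O_0\to\mathcal O_0$ such that $F(L(x))\cong L(x^{-1})$ for all $x\in W$, nor an involutive exact equivalence $F:\mathcal O_0\to\mathcal O_0$ such that $F(L(xw_0))\cong L(x^{-1}w_0)$ for all $x\in W$.
   Context: $\mathcal O_0$ is the principal block of the BGG category $\mathcal O$ for $\mathfrak g=\mathfrak{sl}_3$ with a fixed triangular decomposition (the block containing the trivial module), $W$ is the Weyl group with longest element $w_0$, and for $x\in W$, $L(x)$ is the simple module of highest weight $x\cdot0=x(\rho)-\rho$, where $\rho$ is the half-sum of the positive roots. *)

(* Defs.v *)
From HB Require Import structures.
From mathcomp Require Import all_boot all_order all_fingroup all_algebra.
From mathcomp Require Import boolp classical_sets reals complex.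

Set Implicit Arguments.
Unset Strict Implicit.
Unset Printing Implicit Defensive.

Import GRing.Theory.

Local Open Scope classical_set_scope.
Local Open Scope ring_scope.
Local Open Scope complex_scope.

(* The ground field is R[i] with R : realType, that is, the complex numbers. *)

Definition sl3_pred (R : realType) : {pred 'M[R[i]]_3} := fun A => \tr A == 0.

Lemma sl3_submod_closed (R : realType) : submod_closed (@sl3_pred R).
Proof.
split=> [|a A B /eqP trA /eqP trB]; rewrite unfold_in ?mxtrace0 //.
by rewrite linearP /= trA trB mulr0 addr0.
Qed.

HB.instance Definition _ (R : realType) :=
  GRing.isSubmodClosed.Build R[i] 'M[R[i]]_3 (@sl3_pred R)
    (@sl3_submod_closed R).

Record sl3 (R : realType) :=
  Sl3 { sl3_mx :> 'M[R[i]]_3; sl3_tr0 : sl3_mx \in @sl3_pred R }.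

HB.instance Definition _ (R : realType) := [isSub for @sl3_mx R].
HB.instance Definition _ (R : realType) := [Choice of sl3 R by <:].
HB.instance Definition _ (R : realType) :=
  [SubChoice_isSubLmodule of sl3 R by <:].

Lemma sl3_bracket_tr0 (R : realType) (x y : sl3 R) :
  x *m y - y *m x \in @sl3_pred R.
Proof. by rewrite unfold_in linearB /= mxtrace_mulC subrr. Qed.

Definition sl3_bracket (R : realType) (x y : sl3 R) : sl3 R :=
  Sl3 (sl3_bracket_tr0 x y).

(* Standard triangular decomposition n_- + h + n_+: diagonal matrices for the
   Cartan subalgebra h, strictly upper triangular matrices for n_+. *)
Definition cartan (R : realType) : set (sl3 R) := [set x | is_diag_mx x].

Definition nplus (R : realType) : set (sl3 R) :=
  [set x | forall i j : 'I_3, (j <= i)%N -> x i j = 0].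

Record sl3Module (R : realType) := Sl3Module {
  mod_sort :> lmodType R[i];
  lie_act : sl3 R -> mod_sort -> mod_sort;
  lie_act_linearl : forall v, linear (lie_act^~ v);
  lie_act_linearr : forall x, linear (lie_act x);
  lie_act_bracket : forall x y v,
    lie_act (sl3_bracket x y) v =
      lie_act x (lie_act y v) - lie_act y (lie_act x v) }.

Record sl3Hom (R : realType) (M N : sl3Module R) := Sl3Hom {
  hom_map :> {linear M -> N};
  hom_act : forall x v, hom_map (lie_act x v) = lie_act x (hom_map v) }.

Definition sl3Hom_id (R : realType) (M : sl3Module R) : sl3Hom M M :=
  @Sl3Hom R M M idfun (fun _ _ => erefl).

Lemma sl3Hom_comp_subproof (R : realType) (M N P : sl3Module R)
    (g : sl3Hom N P) (f : sl3Hom M N) x v :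
  (g \o f) (lie_act x v) = lie_act x ((g \o f) v).
Proof. by rewrite /= !hom_act. Qed.

Definition sl3Hom_comp (R : realType) (M N P : sl3Module R)
    (g : sl3Hom N P) (f : sl3Hom M N) : sl3Hom M P :=
  @Sl3Hom R M P (g \o f) (sl3Hom_comp_subproof g f).

Definition mod_iso (R : realType) (M N : sl3Module R) : Prop :=
  exists f : sl3Hom M N, bijective f.

Definition short_exact (R : realType) (A B C : sl3Module R)
    (f : sl3Hom A B) (g : sl3Hom B C) : Prop :=
  [/\ injective f, range f = g @^-1` [set 0] & range g = setT].

(* Linear subspaces of M stable under the action of the elements of a. *)
Definition stable_subspace (R : realType) (a : set (sl3 R)) (M : sl3Module R)
    (U : set M) : Prop :=
  [/\ U 0, forall c u v, U u -> U v -> U (c *: u + v)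
    & forall x u, a x -> U u -> U (lie_act x u)].

Definition lin_subspace (R : realType) (M : sl3Module R) (U : set M) : Prop :=
  stable_subspace set0 U.

Definition submodule (R : realType) (M : sl3Module R) (U : set M) : Prop :=
  stable_subspace setT U.

Definition finite_dim (R : realType) (M : sl3Module R) (U : set M) : Prop :=
  exists s : seq M, U `<=` smallest (@lin_subspace R M) [set` s].

Definition simple_module (R : realType) (M : sl3Module R) : Prop :=
  (exists v : M, v != 0) /\
  forall U : set M, submodule U -> U = [set 0] \/ U = setT.

(* Elements of h^* are written in terms of the coordinate functionals
   eps_i : h |-> h i i, a row vector standing for \sum_i lam_i eps_i; two rows
   give the same functional exactly when they differ by a multiple of
   eps_0 + eps_1 + eps_2. *)
Definition weight (R : realType) := 'rV[R[i]]_3.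

Definition weight_eval (R : realType) (lam : weight R) (h : sl3 R) : R[i] :=
  \sum_(i < 3) lam 0 i * h i i.

Definition weight_space (R : realType) (M : sl3Module R) (lam : weight R) :
    set M :=
  [set v | forall h, cartan h -> lie_act h v = weight_eval lam h *: v].

Definition fin_generated (R : realType) (M : sl3Module R) : Prop :=
  exists s : seq M, smallest (@submodule R M) [set` s] = setT.

(* M is the sum of its weight spaces; the sum is automatically direct. *)
Definition cartan_semisimple (R : realType) (M : sl3Module R) : Prop :=
  smallest (@lin_subspace R M) (\bigcup_(lam : weight R) @weight_space R M lam)
  = setT.

(* U(n_+)v is finite-dimensional for every v. *)
Definition locally_nplus_finite (R : realType) (M : sl3Module R) : Prop :=
  forall v : M, finite_dim (smallest (@stable_subspace R (@nplus R) M) [set v]).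

Definition in_catO (R : realType) (M : sl3Module R) : Prop :=
  [/\ fin_generated M, cartan_semisimple M & locally_nplus_finite M].

(* Blocks of category O: the simple objects are partitioned by the equivalence
   relation generated by non-split extensions, and a module belongs to a block
   when all its composition factors do. *)
Definition nonsplit_ext (R : realType) (S T : sl3Module R) : Prop :=
  exists (E : sl3Module R) (f : sl3Hom S E) (g : sl3Hom E T),
    [/\ in_catO E, short_exact f g
      & ~ exists s : sl3Hom T E, sl3Hom_comp g s = sl3Hom_id T].

Inductive linked (R : realType) : sl3Module R -> sl3Module R -> Prop :=
| linked_iso S T :
    simple_module S -> in_catO S -> simple_module T -> in_catO T ->
    mod_iso S T -> linked S T
| linked_ext S T :
    simple_module S -> in_catO S -> simple_module T -> in_catO T ->
    nonsplit_ext S T -> linked S T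
| linked_sym S T : linked S T -> linked T S
| linked_trans S T U : linked S T -> linked T U -> linked S U.

Definition composition_factor (R : realType) (S M : sl3Module R) : Prop :=
  simple_module S /\
  exists (N : sl3Module R) (i : sl3Hom N M) (p : sl3Hom N S),
    injective i /\ range p = setT.

Lemma trivial_act_linearl (R : realType) (v : R[i]^o) :
  linear ((fun (_ : sl3 R) (_ : R[i]^o) => (0 : R[i]^o))^~ v).
Proof. by move=> a x y; rewrite scaler0 addr0. Qed.

Lemma trivial_act_linearr (R : realType) (x : sl3 R) :
  linear ((fun (_ : sl3 R) (_ : R[i]^o) => (0 : R[i]^o)) x).
Proof. by move=> a u v; rewrite scaler0 addr0. Qed.

Definition trivial_module (R : realType) : sl3Module R :=
  @Sl3Module R R[i]^o (fun _ _ => 0) (@trivial_act_linearl R)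
    (@trivial_act_linearr R) (fun _ _ _ => esym (subrr 0)).

Definition in_O0 (R : realType) (M : sl3Module R) : Prop :=
  in_catO M /\
  forall S : sl3Module R, composition_factor S M -> linked (trivial_module R) S.

Record O0 (R : realType) := MkO0 { O0_mod :> sl3Module R; O0P : in_O0 O0_mod }.

Record O0Functor (R : realType) := MkO0Functor {
  fobj :> O0 R -> O0 R;
  fmor : forall M N : O0 R, sl3Hom M N -> sl3Hom (fobj M) (fobj N);
  fmor_id : forall M : O0 R, fmor (sl3Hom_id M) = sl3Hom_id (fobj M);
  fmor_comp : forall (M N P : O0 R) (g : sl3Hom N P) (f : sl3Hom M N),
    fmor (sl3Hom_comp g f) = sl3Hom_comp (fmor g) (fmor f) }.

Definition functor_id (R : realType) : O0Functor R :=
  @MkO0Functor R id (fun _ _ f => f) (fun _ => erefl) (fun _ _ _ _ _ => erefl).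

Lemma functor_comp_id (R : realType) (G F : O0Functor R) (M : O0 R) :
  fmor G (fmor F (sl3Hom_id M)) = sl3Hom_id (G (F M)).
Proof. by rewrite !fmor_id. Qed.

Lemma functor_comp_comp (R : realType) (G F : O0Functor R) (M N P : O0 R)
    (g : sl3Hom N P) (f : sl3Hom M N) :
  fmor G (fmor F (sl3Hom_comp g f)) =
  sl3Hom_comp (fmor G (fmor F g)) (fmor G (fmor F f)).
Proof. by rewrite !fmor_comp. Qed.

Definition functor_comp (R : realType) (G F : O0Functor R) : O0Functor R :=
  @MkO0Functor R (fun M => G (F M)) (fun M N f => fmor G (fmor F f))
    (functor_comp_id G F) (functor_comp_comp G F).

Definition nat_iso (R : realType) (F G : O0Functor R) : Prop :=
  exists eta : forall M : O0 R, sl3Hom (F M) (G M),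
    (forall M, bijective (eta M)) /\
    forall (M N : O0 R) (f : sl3Hom M N),
      sl3Hom_comp (eta N) (fmor F f) = sl3Hom_comp (fmor G f) (eta M).

Definition is_equivalence (R : realType) (F : O0Functor R) : Prop :=
  exists G : O0Functor R,
    nat_iso (functor_comp G F) (functor_id R) /\
    nat_iso (functor_comp F G) (functor_id R).

Definition exact_functor (R : realType) (F : O0Functor R) : Prop :=
  forall (A B C : O0 R) (f : sl3Hom A B) (g : sl3Hom B C),
    short_exact f g -> short_exact (fmor F f) (fmor F g).

Definition involutive_functor (R : realType) (F : O0Functor R) : Prop :=
  nat_iso (functor_comp F F) (functor_id R).

(* The Weyl group W is identified with 'S_3 by letting x act on weights by
   permuting coordinates, (x lam)_i = lam_(x i). Products in 'S_3 are composed
   from left to right, so by col_permM this is a left action and x * y is the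
   product of x and y in W. *)
Definition weyl_act (R : realType) (x : 'S_3) (lam : weight R) : weight R :=
  col_perm x lam.

(* The permutation exchanging 0 and 2, of maximal length 3. *)
Definition w0 : 'S_3 := perm (@rev_ord_inj 3).

Definition eps (R : realType) (i : 'I_3) : weight R := delta_mx 0 i.

(* The positive roots are eps_i - eps_j for i < j. *)
Definition rho (R : realType) : weight R :=
  2^-1 *: \sum_(i < 3) \sum_(j < 3 | (i < j)%N) (eps R i - eps R j).

Definition dot0 (R : realType) (x : 'S_3) : weight R :=
  weyl_act x (rho R) - rho R.

Definition highest_weight_vector (R : realType) (M : sl3Module R)
    (lam : weight R) (v : M) : Prop :=
  [/\ v != 0, weight_space lam v & forall x, nplus x -> lie_act x v = 0].

(* L is (a copy of) L(x), the simple module of highest weight x.0; these two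
   properties determine it up to isomorphism. *)
Definition is_L (R : realType) (x : 'S_3) (L : sl3Module R) : Prop :=
  simple_module L /\ exists v : L, highest_weight_vector (dot0 R x) v.

(* Main.v *)
Require Import Defs.
From HB Require Import structures.
From mathcomp Require Import all_boot all_order all_fingroup all_algebra.
From mathcomp Require Import boolp classical_sets reals complex.
From mathcomp Require Import ring zify ssrcomplements mpoly.

(** Write a weight of sl3 as a row [(a, b, c)]. The four simple modules that
    matter have highest weights [(0, -1, 1)], [(-1, -1, 2)] and their images
    [(-1, 1, 0)], [(-2, 1, 1)] under the symmetry [sigma] of the Dynkin diagram.
    Call them T, TS, S and ST. Both candidate equivalences exchange one pair of
    modules in this list that [sigma] exchanges, and fix the modules in the
    other pair: the first one exchanges TS with ST and fixes T and S, the second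
    one, after the shift by the longest element, exchanges T with S and fixes TS
    and ST. Non-split extensions between simple modules cannot exclude this, as
    the Ext-quiver of the block is symmetric in this way. A module with three
    composition factors can: there is a uniserial module in the block with
    layers TS, T, TS, but none with layers ST, T, ST. By composition with the
    twist by [sigma], none has layers TS, S, TS either.

    The uniserial module with layers TS, T, TS is [Mmod]. All modules are
    realized by differential operators on polynomials in two variables.
    [Vmod d] is the generalized Verma module of highest weight [(0, 0, d)] for
    the parabolic subalgebra whose Levi factor contains the root vectors of
    E_01 and E_10: [Vmod 3] is TS, and the polynomials without constant term in
    [Vmod 0] form [Imod], which is T, with trivial quotient. [Mmod] is the tensor
    product of [Vmod 2] with the natural representation; contraction maps it
    onto [Vmod 3] with kernel [Nmod], and [Nmod] is an extension of [Imod] by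
    [Vmod 3] ([exact_N_M_V], [exact_V_N_I]). Neither sequence splits
    ([homX_not_split], [homC_not_split]). The non-split extensions [Vmod 0] and
    [Nmod] also show that T and TS, hence S and ST, are linked to the trivial
    module, so that all these modules do lie in the principal block.

    A module M with layers ST, T, ST is excluded in [no_uniserial_model]. Let v
    be a vector of weight [(-2, 1, 1)] in M over the highest weight vector of the
    quotient ST, and put w = E_01 v and y = E_21 v, which lie in the submodule
    with layers T, ST. For weight reasons the images of w and y in T are multiples
    of one vector each, and the identity E_01 y = E_21 w relates the two
    coefficients: it gives 2 y + E_20 w = 0. Applying E_12, which kills y and w,
    leaves E_10 w = 0. If w is zero, so is y, and v generates a copy of ST which
    splits off at the top. If w is nonzero, it generates a quotient of the
    generalized Verma module [Nmod]; the kernel contains the submodule TS of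
    [Nmod], whose highest weight does not occur, so that w generates a copy of T
    which splits off from the submodule with layers T, ST.

    An exact functor F preserves both exact sequences, and if F is an involution
    then it preserves non-splitness ([split_epi_reflect]). The image of [Mmod]
    under the first candidate, and the twist by [sigma] of its image under the
    second one, would have layers ST, T, ST. *)

Set Implicit Arguments.
Unset Strict Implicit.
Unset Printing Implicit Defensive.

Import GRing.Theory Num.Theory.

Local Open Scope classical_set_scope.
Local Open Scope ring_scope.
Local Open Scope complex_scope.

Local Notation i0 := (ord0 : 'I_2).
Local Notation i1 := (ord_max : 'I_2).

(** * Homomorphisms and submodules *)

HB.instance Definition _ (R : realType) (M : sl3Module R) (x : sl3 R) :=
  GRing.isLinear.Build R[i] M M *:%R (@lie_act R M x) (lie_act_linearr x).

Definition linear_pack (K : pzRingType) (U V : lmodType K) (f : U -> V)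
    (f_lin : linear f) : {linear U -> V} :=
  HB.pack f (GRing.isLinear.Build K U V *:%R f f_lin).

Section Homs.
Variable R : realType.
Implicit Types M N A B : sl3Module R.

Lemma lie_actDl M (x y : sl3 R) (v : M) :
  lie_act (x + y) v = lie_act x v + lie_act y v.
Proof. exact: (linearD (linear_pack (lie_act_linearl v))). Qed.

Lemma lie_actZl M c (x : sl3 R) (v : M) : lie_act (c *: x) v = c *: lie_act x v.
Proof. exact: (linearZ_LR (linear_pack (lie_act_linearl v))). Qed.

Lemma lie_actNl M (x : sl3 R) (v : M) : lie_act (- x) v = - lie_act x v.
Proof. exact: (linearN (linear_pack (lie_act_linearl v))). Qed.

Lemma sl3Hom_ext M N (f g : sl3Hom M N) : f =1 g -> f = g.
Proof.
case: f g => [f hf] [g hg] /= fg.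
have E : f = g.
  case: f g fg {hf hg} => [f [[F1] [F2]]] [g [[G1] [G2]]] /= fg.
  have Efg : f = g by apply/funext.
  subst g.
  by congr (GRing.Linear.Pack (GRing.Linear.Class _ _)); congr (_ _);
    apply/Prop_irrelevance.
by subst g; congr Sl3Hom; apply/Prop_irrelevance.
Qed.

Lemma hom_lift A M N (f : sl3Hom A M) (h : sl3Hom N M) :
    injective f -> (forall w, exists a, f a = h w) ->
  exists k : sl3Hom N A, forall w, f (k w) = h w.
Proof.
move=> f_inj /choice[k fk].
have k_lin : linear k by move=> c u v; apply: f_inj; rewrite linearP !fk linearP.
have k_act x v : k (lie_act x v) = lie_act x (k v).
  by apply: f_inj; rewrite fk !hom_act fk.
by exists (@Sl3Hom R N A (linear_pack k_lin) k_act).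
Qed.

Lemma hom_factor M N A (p : sl3Hom M N) (h : sl3Hom M A) :
    (forall y, exists x, p x = y) -> (forall x, p x = 0 -> h x = 0) ->
  exists k : sl3Hom N A, forall x, k (p x) = h x.
Proof.
move=> /choice[q pq] ph.
have hE x y : p x = p y -> h x = h y.
  by move=> E; apply/subr0_eq; rewrite -linearB; apply: ph; rewrite linearB E subrr.
have k_lin : linear (h \o q).
  by move=> c u v /=; rewrite -linearP; apply: hE; rewrite linearP !pq.
have k_act x v : (h \o q) (lie_act x v) = lie_act x ((h \o q) v).
  by rewrite /= -hom_act; apply: hE; rewrite hom_act !pq.
exists (@Sl3Hom R N A (linear_pack k_lin) k_act) => x /=.
by apply: hE; rewrite pq.
Qed.

Lemma hom_inverse M N (f : sl3Hom M N) : bijective f ->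
  exists g : sl3Hom N M, cancel f g /\ cancel g f.
Proof.
move=> f_bij; have [g gf] : exists k : sl3Hom N M, forall x, k (f x) = sl3Hom_id M x.
  apply: hom_factor => [y|x fx0]; first by have [g _ gK] := f_bij; exists (g y).
  by apply: (bij_inj f_bij); rewrite fx0 linear0.
by exists g; split=> //; apply/(bij_can_sym f_bij).
Qed.

Lemma mod_iso_sym M N : mod_iso M N -> mod_iso N M.
Proof. by case=> f /hom_inverse[g [fK gK]]; exists g; exists f. Qed.

Lemma hom_bij M N (f : sl3Hom M N) :
  (forall x, f x = 0 -> x = 0) -> (forall y, exists x, f x = y) -> bijective f.
Proof.
move=> f_inj /choice[g gK]; exists g => // x; apply/subr0_eq/f_inj.
by rewrite linearB gK subrr.
Qed.

Lemma short_exactP A M B (f : sl3Hom A M) (g : sl3Hom M B) :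
  short_exact f g <->
  [/\ (forall a, f a = 0 -> a = 0), (forall a, g (f a) = 0),
      (forall m, g m = 0 -> exists a, f a = m) & (forall b, exists m, g m = b)].
Proof.
split=> [[f_inj /seteqP[gf fg] /seteqP[_ gS]]|[f_inj gf fg gS]]; split.
- by move=> a fa; apply: f_inj; rewrite fa linear0.
- by move=> a; apply: gf; exists a.
- by move=> m /fg[a _ <-]; exists a.
- by move=> b; have [//|m _ <-] := gS b; exists m.
- by move=> a b E; apply/subr0_eq/f_inj; rewrite linearB E subrr.
- by apply/seteqP; split=> [_ [a _ <-]|m /= /fg[a <-]]; [exact: gf | exists a].
- by apply/seteqP; split=> // b _; have [m <-] := gS b; exists m.
Qed.

Definition split_epi M N (g : sl3Hom M N) : Prop :=
  exists s : sl3Hom N M, sl3Hom_comp g s = sl3Hom_id N.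

Lemma split_epiP M N (g : sl3Hom M N) :
  split_epi g <-> exists s : sl3Hom N M, cancel s g.
Proof.
split=> -[s gs]; exists s; last exact: sl3Hom_ext.
by move=> x; rewrite -[RHS]/(sl3Hom_id N x) -gs.
Qed.

End Homs.

Section Submodules.
Variable R : realType.
Implicit Types (M N A B L S : sl3Module R) (a : set (sl3 R)).

Lemma smallest_stable a M (G : set M) :
  stable_subspace a (smallest (@stable_subspace R a M) G).
Proof.
split=> [U [[]] //|c u v Gu Gv U UG|x u ax Gu U UG].
  by case: (UG) => -[_ Ulin _] GU; apply: Ulin; [apply: Gu|apply: Gv].
by case: (UG) => -[_ _ Ua] GU; apply: Ua => //; apply: Gu.
Qed.

Lemma stable_preimage a M N (f : sl3Hom M N) (U : set N) :
  stable_subspace a U -> stable_subspace a (f @^-1` U).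
Proof.
case=> U0 Ulin Ua; split=> [|c u v Uu Uv|x u ax Uu] /=.
- by rewrite linear0.
- by rewrite linearP; apply: Ulin.
- by rewrite hom_act; apply: Ua.
Qed.

Lemma stable_image a M N (f : sl3Hom M N) (U : set M) :
  stable_subspace a U -> stable_subspace a (f @` U).
Proof.
case=> U0 Ulin Ua; split=> [|c _ _ [u Uu <-] [v Uv <-]|x _ ax [u Uu <-]].
- by exists 0 => //; rewrite linear0.
- by exists (c *: u + v); [apply: Ulin|rewrite linearP].
- by exists (lie_act x u); [apply: Ua|rewrite hom_act].
Qed.

Lemma stableD a M (U : set M) u v :
  stable_subspace a U -> U u -> U v -> U (u + v).
Proof. by case=> _ Ulin _ Uu Uv; rewrite -[u]scale1r; apply: Ulin. Qed.

Lemma stableZ a M (U : set M) c u : stable_subspace a U -> U u -> U (c *: u).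
Proof. by case=> U0 Ulin _ Uu; rewrite -[_ *: _]addr0; apply: Ulin. Qed.

Lemma stable_sum a M (U : set M) I (r : seq I) (P : pred I) (F : I -> M) :
    stable_subspace a U -> (forall i, P i -> U (F i)) ->
  U (\sum_(i <- r | P i) F i).
Proof.
move=> aU UF; elim/big_ind: _ => // [|u v Uu Uv]; first by case: aU.
exact: (stableD aU).
Qed.

Definition submod_pred M (U : set M) (subU : submodule U) : {pred M} :=
  fun v => `[< U v >].

Lemma submod_pred_closed M (U : set M) (subU : submodule U) :
  submod_closed (submod_pred subU).
Proof.
have [U0 Ulin _] := subU; split=> [|c u v]; first exact/asboolP.
by move=> /asboolP Uu /asboolP Uv; apply/asboolP/Ulin.
Qed.

End Submodules.

HB.instance Definition _ (R : realType) (M : sl3Module R) (U : set M)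
    (subU : submodule U) :=
  GRing.isSubmodClosed.Build R[i] M (submod_pred subU)
    (submod_pred_closed subU).

Record submod_type (R : realType) (M : sl3Module R) (U : set M)
    (subU : submodule U) :=
  SubmodType { submod_val :> M; submod_valP : submod_val \in submod_pred subU }.

HB.instance Definition _ (R : realType) (M : sl3Module R) (U : set M)
  (subU : submodule U) := [isSub for @submod_val R M U subU].
HB.instance Definition _ (R : realType) (M : sl3Module R) (U : set M)
  (subU : submodule U) := [Choice of submod_type subU by <:].
HB.instance Definition _ (R : realType) (M : sl3Module R) (U : set M)
  (subU : submodule U) := [SubChoice_isSubLmodule of submod_type subU by <:].

Section SubmoduleModule.
Variables (R : realType) (M : sl3Module R) (U : set M) (subU : submodule U).

Lemma submod_mem (u : submod_type subU) : U (submod_val u).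
Proof. exact/asboolP/(submod_valP u). Qed.

Lemma submod_act_subproof x (u : submod_type subU) :
  lie_act x (submod_val u) \in submod_pred subU.
Proof. by have [_ _ Ua] := subU; apply/asboolP/Ua => //; apply: submod_mem. Qed.

Definition submod_act x (u : submod_type subU) : submod_type subU :=
  SubmodType (submod_act_subproof x u).

Lemma submod_act_linearl u : linear (submod_act^~ u).
Proof.
move=> c x y; apply: val_inj; rewrite linearP /=.
by rewrite lie_actDl lie_actZl.
Qed.

Lemma submod_act_linearr x : linear (submod_act x).
Proof. by move=> c u v; apply: val_inj; rewrite linearP /= linearP. Qed.

Lemma submod_act_bracket x y u :
  submod_act (sl3_bracket x y) u =
    submod_act x (submod_act y u) - submod_act y (submod_act x u).
Proof. by apply: val_inj; rewrite linearB /= lie_act_bracket. Qed.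

Definition submodM : sl3Module R :=
  Sl3Module submod_act_linearl submod_act_linearr submod_act_bracket.

Lemma submod_val_linear : linear (fun u : submodM => submod_val u).
Proof. by move=> c u v; rewrite [LHS](linearP val). Qed.

Definition submod_incl : sl3Hom submodM M :=
  @Sl3Hom R submodM M (linear_pack submod_val_linear) (fun _ _ => erefl).

Lemma submod_incl_inj : injective submod_incl.
Proof. exact: val_inj. Qed.

Lemma submod_incl_mem u : U (submod_incl u).
Proof. exact: submod_mem. Qed.

Lemma submod_inclP v : U v -> exists u, submod_incl u = v.
Proof. by move/asboolP => Uv; exists (SubmodType Uv). Qed.

End SubmoduleModule.

(** * Composition factors *)

Section CompositionFactors.
Variable R : realType.
Implicit Types (M N A B L S : sl3Module R).

Lemma ker_submodule M N (f : sl3Hom M N) : submodule [set x | f x = 0].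
Proof.
split=> [|c u v /= fu fv|x u _ /= fu] /=; first by rewrite linear0.
  by rewrite linearP fu fv scaler0 addr0.
by rewrite hom_act fu linear0.
Qed.

Lemma range_submodule M N (f : sl3Hom M N) : submodule (range f).
Proof. by apply: stable_image; split. Qed.

Lemma simple_range L M (f : sl3Hom L M) x :
  simple_module M -> f x != 0 -> forall y, exists z, f z = y.
Proof.
move=> [_ /(_ _ (range_submodule f))[|] /seteqP[sub sup]] fx y.
  by have /eqP := sub (f x) (imageT f x); rewrite (negPf fx).
by have [//|z _ <-] := sup y; exists z.
Qed.

Lemma simple_ker L M (f : sl3Hom L M) x :
  simple_module L -> f x != 0 -> forall z, f z = 0 -> z = 0.
Proof.
move=> [_ /(_ _ (ker_submodule f))[|] /seteqP[sub sup]] fx z fz.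
  exact: sub.
by have /eqP := sup x I; rewrite (negPf fx).
Qed.

Lemma composition_factor_simple L S :
  simple_module L -> composition_factor S L -> mod_iso L S.
Proof.
move=> Lsimple [[[s s0] Ssimple] [N [i [p [i_inj pS]]]]].
have p_surj y : exists x, p x = y.
  by have /seteqP[_ /(_ y I)[x _ <-]] := pS; exists x.
have [n pn] := p_surj s.
have n0 : i n != 0.
  apply: contra_neq s0 => /eqP; rewrite -(linear0 i) => /eqP/i_inj n0.
  by rewrite -pn n0 linear0.
have [g [_ gK]] : exists g : sl3Hom L N, cancel i g /\ cancel g i.
  apply: hom_inverse; apply: hom_bij; last exact: (simple_range Lsimple n0).
  by move=> x ix; apply: i_inj; rewrite ix linear0.
have ipg x : sl3Hom_comp p g (i x) = p x.
  by congr (p _); apply: i_inj; rewrite gK.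
exists (sl3Hom_comp p g); apply: hom_bij.
  by apply: (@simple_ker _ _ _ (i n)) => //; rewrite ipg pn.
by move=> y; have [x <-] := p_surj y; exists (i x).
Qed.

(** Let S be the quotient of the submodule N of M by the kernel of p. Either p
    maps the kernel of N -> B, which embeds into A, onto S, or p kills this
    kernel and factors through the image of N in B. *)
Lemma composition_factor_ext A M B (f : sl3Hom A M) (g : sl3Hom M B) S :
    short_exact f g -> composition_factor S M ->
  composition_factor S A \/ composition_factor S B.
Proof.
move=> /short_exactP[f_inj gf fg g_surj] [Ssimple [N [i [p [i_inj pS]]]]].
have p_surj y : exists x, p x = y.
  by have /seteqP[_ /(_ y I)[x _ <-]] := pS; exists x.
pose K := submod_incl (ker_submodule (sl3Hom_comp g i)).
have [[u pu]|pK] := pselect (exists u, p (K u) != 0).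
  left; split=> //.
  have [k fk] : exists k : sl3Hom _ A, forall w, f (k w) = sl3Hom_comp i K w.
    apply: hom_lift => [x y E|w].
      by apply/subr0_eq/f_inj; rewrite linearB E subrr.
    by apply/fg/(submod_incl_mem w).
  exists _, k, (sl3Hom_comp p K); split=> [x y E|].
    by apply/(@submod_incl_inj _ _ _ _)/i_inj; rewrite -[LHS]fk -[RHS]fk E.
  have := @simple_range _ _ (sl3Hom_comp p K) u Ssimple pu.
  by move=> sur; apply/seteqP; split=> // y _; have [z <-] := sur y; exists z.
right; split=> //.
pose J := submod_incl (range_submodule (sl3Hom_comp g i)).
have [h Jh] : exists h : sl3Hom N _, forall w, J (h w) = sl3Hom_comp g i w.
  apply: hom_lift => [|w]; first exact: submod_incl_inj.
  by apply: submod_inclP; exists w.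
have [k kh] : exists k : sl3Hom _ S, forall x, k (h x) = p x.
  apply: hom_factor => [y|x hx0].
    have [x _ xy] := submod_incl_mem y; exists x.
    by apply: submod_incl_inj; rewrite -xy -Jh.
  have [|u ux] := @submod_inclP _ _ _ (ker_submodule (sl3Hom_comp g i)) x.
    by rewrite /= -[LHS]Jh hx0 linear0.
  by apply/eqP/negP => px; apply: pK; exists u; rewrite /K ux; apply/negP.
exists _, J, k; split; first exact: submod_incl_inj.
apply/seteqP; split=> // y _; have [x <-] := p_surj y.
by exists (h x).
Qed.

End CompositionFactors.

(** * Category O *)

Section CategoryO.
Variable R : realType.
Implicit Types (M N : sl3Module R) (a : set (sl3 R)).

Lemma smallest_stable_image a M N (f : sl3Hom M N) (G : set M) :
  smallest (@stable_subspace R a N) (f @` G) `<=`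
  f @` smallest (@stable_subspace R a M) G.
Proof.
apply: smallest_sub; first exact/stable_image/smallest_stable.
by move=> _ [x Gx <-]; exists x => //; apply: sub_gen_smallest.
Qed.

Lemma smallest_stable_map a M N (f : sl3Hom M N) (G : set M) (x : M) :
  smallest (@stable_subspace R a M) G x ->
  smallest (@stable_subspace R a N) (f @` G) (f x).
Proof.
move: x; apply: smallest_sub; first exact/stable_preimage/smallest_stable.
by move=> x Gx; apply: sub_gen_smallest; exists x.
Qed.

Lemma weight_space_hom M N (f : sl3Hom M N) lam v :
  weight_space lam v -> weight_space lam (f v).
Proof. by move=> vlam h /vlam E; rewrite -hom_act E linearZ. Qed.

Lemma weight_space_inj M N (f : sl3Hom M N) lam v :
  (forall x, f x = 0 -> x = 0) -> weight_space lam (f v) -> weight_space lam v.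
Proof.
move=> f_inj vlam h /vlam E; apply/subr0_eq/f_inj.
by rewrite linearB linearZ hom_act E subrr.
Qed.

Lemma seq_image (T U : choiceType) (f : T -> U) (s : seq T) :
  f @` [set` s] = [set` map f s].
Proof.
apply/seteqP; split=> [_ [x /= xs <-]|y /= /mapP[x xs ->]].
  exact: map_f.
by exists x.
Qed.

Lemma in_catO_quotient M N (f : sl3Hom M N) :
  (forall y, exists x, f x = y) -> in_catO M -> in_catO N.
Proof.
move=> f_surj [[s sM] /seteqP[_ Mss] Mfin]; split.
- exists (map f s); apply/seteqP; split=> // y _; have [x <-] := f_surj y.
  rewrite -seq_image; apply: smallest_stable_map.
  by have /seteqP[_ /(_ x I)] := sM.
- apply/seteqP; split=> // y _; have [x <-] := f_surj y.
  have := smallest_stable_map (f := f) (Mss x I).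
  apply: sub_smallest2r; first exact: smallest_stable.
  move=> _ [z [lam _ zlam] <-].
  by exists lam => //; apply: weight_space_hom.
move=> y; have [x <-] := f_surj y; have [t xt] := Mfin x.
exists (map f t) => z; rewrite -(image_set1 f x) => /smallest_stable_image.
by move=> [u /xt ut <-]; rewrite -seq_image; apply: smallest_stable_map.
Qed.

Lemma in_catO_iso M N : mod_iso M N -> in_catO M -> in_catO N.
Proof.
by case=> f [g _ gK]; apply: (in_catO_quotient (f := f)) => y; exists (g y).
Qed.

Lemma linked_right (S T : sl3Module R) :
  linked S T -> [/\ simple_module S, in_catO S, simple_module T & in_catO T].
Proof. by elim=> // {}S {}T; [move=> _ []|move=> U _ [? ? _ _] _ []]. Qed.

End CategoryO.

(** * Matrix units *)

Section MatrixUnits.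
Variable R : realType.
Implicit Types (M N : sl3Module R).

Definition unit_mx_traceless (i j : 'I_3) : 'M[R[i]]_3 :=
  delta_mx i j - ((i == j)%:R / 3) *: 1%:M.

Lemma unit_mx_tr0 i j : unit_mx_traceless i j \in @sl3_pred R.
Proof.
rewrite unfold_in linearB linearZ /= mxtrace1 [\tr (delta_mx _ _)]/mxtrace.
rewrite (bigD1 i) //= big1 => [|k ki]; last by rewrite mxE (negPf ki).
rewrite mxE eqxx /= addr0 divfK ?subrr //.
by rewrite pnatr_eq0.
Qed.

(** The diagonal units are included, made traceless, so that the relations of gl3
    hold for all indices ([unit_bracket]) and all nine units span ([unit_span]). *)
Definition Eu i j : sl3 R := Sl3 (unit_mx_tr0 i j).

Lemma EuE i j k l : Eu i j k l =
  ((k == i) && (l == j))%:R - (i == j)%:R / 3 * (k == l)%:R.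
Proof. by rewrite /= !mxE. Qed.

(** Removing the trace does not change a commutator, which is why the traceless
    matrix units satisfy the relations of gl3. *)
Lemma comm_shift (A B : 'M[R[i]]_3) a b :
  (A - a *: 1%:M) *m (B - b *: 1%:M) - (B - b *: 1%:M) *m (A - a *: 1%:M) =
  A *m B - B *m A.
Proof.
rewrite !mulmxBl !mulmxBr -!scalemxAl -!scalemxAr !mul1mx !mulmx1 !scalerA.
rewrite [b * a]mulrC; move: (A *m B) (B *m A) => X Y.
by apply/matrixP => i j; rewrite !mxE; ring.
Qed.

Lemma unit_bracket i j k l :
  sl3_bracket (Eu i j) (Eu k l) = (j == k)%:R *: Eu i l - (l == i)%:R *: Eu k j.
Proof.
apply: val_inj; rewrite linearB !linearZ /= /unit_mx_traceless comm_shift.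
have mul_delta (a b c d : 'I_3) :
    delta_mx a b *m delta_mx c d = (b == c)%:R *: delta_mx a d :> 'M[R[i]]_3.
  by rewrite mul_delta_mx_cond scaler_nat.
rewrite !mul_delta (eq_sym i l) (eq_sym k j); apply/matrixP => p q.
by rewrite !mxE; ring.
Qed.

Lemma sl3_tr (x : sl3 R) : \sum_i x i i = 0.
Proof. by have := sl3_tr0 x; rewrite unfold_in => /eqP. Qed.

Lemma unit_span (x : sl3 R) : x = \sum_i \sum_j x i j *: Eu i j.
Proof.
have mx_sum (F : 'I_3 -> sl3 R) : sl3_mx (\sum_i F i) = \sum_i sl3_mx (F i).
  exact: (linear_sum val).
apply: val_inj; rewrite /= mx_sum; apply/matrixP => p q; rewrite summxE.
under eq_bigr => i _.
  rewrite mx_sum summxE; under eq_bigr => j _ do rewrite [_ _ q]mxE EuE mulrBr.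
  rewrite sumrB; over.
rewrite sumrB (bigD1 p) //= (bigD1 q) //= !eqxx mulr1.
rewrite big1 => [|j /negPf jq]; last by rewrite eq_sym jq andbF mulr0.
rewrite big1 => [|i /negPf ip]; last first.
  by rewrite big1 // => j _; rewrite eq_sym ip mulr0.
rewrite !addr0 (eq_bigr (fun i => x i i * ((p == q)%:R / 3))); last first.
  move=> i _; rewrite (bigD1 i) //= eqxx big1 ?addr0; last first.
    by move=> j /negPf ji; rewrite eq_sym ji !mul0r mulr0.
  by rewrite mul1r [3^-1 * _]mulrC.
by rewrite -mulr_suml sl3_tr mul0r subr0.
Qed.

Lemma unit_act M i j k l (v : M) :
  lie_act (Eu i j) (lie_act (Eu k l) v) =
  lie_act (Eu k l) (lie_act (Eu i j) v) +
    ((j == k)%:R *: lie_act (Eu i l) v - (l == i)%:R *: lie_act (Eu k j) v).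
Proof.
by rewrite -!lie_actZl -lie_actNl -lie_actDl -unit_bracket lie_act_bracket addrC subrK.
Qed.

Lemma cartan_bracket (h : sl3 R) i j : cartan h ->
  sl3_bracket h (Eu i j) = (h i i - h j j) *: Eu i j.
Proof.
move=> /diag_mxP[d hd]; apply: val_inj; rewrite linearZ /= /unit_mx_traceless.
have := comm_shift h (delta_mx i j) 0 ((i == j)%:R / 3).
rewrite scale0r subr0 => ->; rewrite hd mul_diag_mx mul_mx_diag.
apply/matrixP => p q; rewrite !mxE !eqxx !mulr1n.
have [->|ij] := eqVneq i j.
  rewrite subrr mul0r; have [->|_] := eqVneq p j; last by rewrite mulr0 mul0r subrr.
  by have [->|_] := eqVneq q j; rewrite ?mulr0 ?mul0r ?mulr1 ?mul1r subrr.
rewrite !mul0r subr0; have [->|_] := eqVneq p i; last by rewrite !mulr0 mul0r subr0.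
by have [->|_] := eqVneq q j; rewrite ?mulr0 ?mul0r ?mulr1 ?mul1r ?subr0.
Qed.

Lemma weight_space_act M lam i j (v : M) : weight_space lam v ->
  weight_space (lam + eps R i - eps R j) (lie_act (Eu i j) v).
Proof.
move=> vlam h hc; rewrite -[LHS](subrK (lie_act (Eu i j) (lie_act h v))).
rewrite -lie_act_bracket cartan_bracket // (vlam h hc) lie_actZl linearZ /= -scalerDl.
congr (_ *: _); rewrite /weight_eval.
under [RHS]eq_bigr => k _ do rewrite !mxE /= mulrBl mulrDl.
rewrite sumrB big_split /=.
have sum_eps k : \sum_(m < 3) (m == k)%:R * h m m = h k k.
  by rewrite (bigD1 k) //= eqxx mul1r big1 ?addr0 // => m /negPf->; rewrite mul0r.
by rewrite !sum_eps; ring.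
Qed.

End MatrixUnits.

(** * Twisting by the diagram automorphism *)

Section Twist.
Variable R : realType.
Implicit Types (M N S T : sl3Module R) (a : set (sl3 R)).

(** Minus the reflection in the antidiagonal: the automorphism that exchanges the
    two simple roots and preserves the triangular decomposition. *)
Definition sigma_mx (x : 'M[R[i]]_3) : 'M[R[i]]_3 :=
  \matrix_(i, j) - x (rev_ord j) (rev_ord i).

Lemma sigma_tr0 (x : sl3 R) : sigma_mx x \in @sl3_pred R.
Proof.
rewrite unfold_in /mxtrace; under eq_bigr do rewrite mxE.
have := sl3_tr x; rewrite (reindex_inj rev_ord_inj) /= sumrN => ->.
by rewrite oppr0.
Qed.

Definition sigma (x : sl3 R) : sl3 R := Sl3 (sigma_tr0 x).

Lemma sigmaE x i j : sigma x i j = - x (rev_ord j) (rev_ord i).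
Proof. by rewrite /= mxE. Qed.

Lemma sigma_linear : linear sigma.
Proof.
move=> c x y; apply/val_inj/matrixP => i j; rewrite linearP /= !mxE.
by ring.
Qed.

Lemma sigmaK : involutive sigma.
Proof. by move=> x; apply/val_inj/matrixP => i j; rewrite /= !mxE !rev_ordK opprK. Qed.

Lemma sigma_bracket x y : sigma (sl3_bracket x y) = sl3_bracket (sigma x) (sigma y).
Proof.
apply/val_inj/matrixP => i j; rewrite /= !mxE opprB.
congr (_ - _); rewrite (reindex_inj rev_ord_inj); apply: eq_bigr => k _.
  by rewrite !mxE mulrNN mulrC.
by rewrite !mxE mulrNN mulrC.
Qed.

Lemma sigma_unit i j : sigma (Eu R i j) = - Eu R (rev_ord j) (rev_ord i).
Proof.
apply/val_inj/matrixP => p q; rewrite linearN /= !mxE.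
rewrite !(inj_eq rev_ord_inj) andbC -!(can2_eq rev_ordK rev_ordK).
by rewrite (eq_sym j) (eq_sym q).
Qed.

Lemma twist_act_linearl M (v : M) : linear (fun x => lie_act (sigma x) v).
Proof. by move=> c x y; rewrite sigma_linear lie_actDl lie_actZl. Qed.

Lemma twist_act_bracket M x y (v : M) :
  lie_act (sigma (sl3_bracket x y)) v =
    lie_act (sigma x) (lie_act (sigma y) v) -
    lie_act (sigma y) (lie_act (sigma x) v).
Proof. by rewrite sigma_bracket lie_act_bracket. Qed.

Definition twist M : sl3Module R :=
  @Sl3Module R M (fun x => lie_act (sigma x)) (@twist_act_linearl M)
    (fun x => lie_act_linearr (sigma x)) (@twist_act_bracket M).

Definition twist_hom M N (f : sl3Hom M N) : sl3Hom (twist M) (twist N) :=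
  @Sl3Hom R (twist M) (twist N) f (fun x => hom_act f (sigma x)).

Lemma untwist_subproof M N (f : sl3Hom M (twist N)) x (v : M) :
  f (lie_act (sigma x) v) = @lie_act R N x (f v).
Proof. by rewrite hom_act /= sigmaK. Qed.

Definition twist_coadjoint M N (f : sl3Hom M (twist N)) : sl3Hom (twist M) N :=
  @Sl3Hom R (twist M) N f (untwist_subproof f).

Lemma untwist_hom_subproof M N (f : sl3Hom (twist M) (twist N)) x (v : M) :
  f (lie_act x v) = @lie_act R N x (f v).
Proof. by have := hom_act f (sigma x) v; rewrite /= !sigmaK. Qed.

Definition untwist_hom M N (f : sl3Hom (twist M) (twist N)) : sl3Hom M N :=
  @Sl3Hom R M N f (untwist_hom_subproof f).

Lemma mod_iso_twist M N : mod_iso M N -> mod_iso (twist M) (twist N).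
Proof. by case=> f fbij; exists (twist_hom f). Qed.

Lemma mod_iso_twistK M : mod_iso (twist (twist M)) M.
Proof.
exists (twist_coadjoint (sl3Hom_id (twist M))).
by exists id.
Qed.

Lemma stable_twist a M : (forall x, a x -> a (sigma x)) ->
  @stable_subspace R a (twist M) = @stable_subspace R a M.
Proof.
move=> aS; apply/funext => U; apply/propext; split=> -[U0 Ulin Ua]; split=> //.
  by move=> x u ax; rewrite -(sigmaK x); apply/Ua/aS.
by move=> x u ax; apply/Ua/aS.
Qed.

Lemma sigma_nplus x : nplus x -> nplus (sigma x).
Proof.
by move=> xn i j ji; rewrite sigmaE xn ?oppr0 //= leq_sub2l.
Qed.

Lemma sigma_cartan x : cartan x -> cartan (sigma x).
Proof.
move=> /is_diag_mxP xd; apply/is_diag_mxP => i j ij.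
rewrite sigmaE xd ?oppr0 //; apply: contra_neq ij => /val_inj/rev_ord_inj.
by move->.
Qed.

Definition sigma_wt (lam : weight R) : weight R := \row_i - lam 0 (rev_ord i).

Lemma sigma_wtK : involutive sigma_wt.
Proof. by move=> lam; apply/rowP => i; rewrite !mxE rev_ordK opprK. Qed.

Lemma weight_eval_sigma lam h : weight_eval lam (sigma h) = weight_eval (sigma_wt lam) h.
Proof.
rewrite /weight_eval [RHS](reindex_inj rev_ord_inj); apply: eq_bigr => i _.
by rewrite sigmaE mxE rev_ordK mulrN mulNr.
Qed.

Lemma weight_space_twist M lam (v : M) :
  @weight_space R (twist M) lam v <-> @weight_space R M (sigma_wt lam) v.
Proof.
split=> vlam h hc.
  rewrite -weight_eval_sigma -{1}(sigmaK h).
  exact: (vlam (sigma h) (sigma_cartan hc)).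
by rewrite /= (vlam _ (sigma_cartan hc)) weight_eval_sigma sigma_wtK.
Qed.

Lemma fin_generated_twist M : fin_generated M -> fin_generated (twist M).
Proof.
case=> s sM; exists s; rewrite -[RHS]sM.
by rewrite /submodule; congr (smallest _ _); apply: stable_twist.
Qed.

Lemma in_catO_twist M : in_catO M -> in_catO (twist M).
Proof.
case=> Mfg Mss Mfin; split; first exact: fin_generated_twist.
  apply: etrans Mss; congr (smallest _ _).
    exact: stable_twist.
  apply/seteqP; split=> [v [lam _ /weight_space_twist vlam]|v [lam _ vlam]].
    by exists (sigma_wt lam).
  by exists (sigma_wt lam) => //; apply/weight_space_twist; rewrite sigma_wtK.
move=> v; have [s vs] := Mfin v; exists s.
rewrite /lin_subspace (stable_twist M (a := set0)) //.
by rewrite (stable_twist M sigma_nplus).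
Qed.

Lemma simple_twist M : simple_module M -> simple_module (twist M).
Proof.
case=> Mn0 Msimple; split=> // U; rewrite /submodule stable_twist //.
exact: Msimple.
Qed.

Lemma short_exact_twist (A M B : sl3Module R) (f : sl3Hom A M) (g : sl3Hom M B) :
  short_exact f g -> short_exact (twist_hom f) (twist_hom g).
Proof. by []. Qed.

Lemma split_epi_twist M N (g : sl3Hom M N) :
  split_epi (twist_hom g) -> split_epi g.
Proof.
by move=> /split_epiP[s gs]; apply/split_epiP; exists (untwist_hom s).
Qed.

Lemma linked_twist S T : linked S T -> linked (twist S) (twist T).
Proof.
elim=> {S T} [S T|S T|S T _|S T U _ ST _].
- move=> Ss So Ts To ST; apply: linked_iso; last exact: mod_iso_twist.
  - exact: simple_twist.
  - exact: in_catO_twist.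
  - exact: simple_twist.
  - exact: in_catO_twist.
- move=> Ss So Ts To [X [f [g [Xo fg gs]]]]; apply: linked_ext.
  - exact: simple_twist.
  - exact: in_catO_twist.
  - exact: simple_twist.
  - exact: in_catO_twist.
  exists (twist X), (twist_hom f), (twist_hom g); split=> //.
    exact: in_catO_twist.
  by move/split_epi_twist.
- exact: linked_sym.
- exact: linked_trans.
Qed.

End Twist.

(** * Modules linked to the trivial module *)

Section TrivialModule.
Variable R : realType.
Local Notation triv := (trivial_module R).

Lemma trivial_simple : simple_module triv.
Proof.
split=> [|U [U0 Ulin _]]; first by exists 1; rewrite oner_eq0.
have [[u u0 Uu]|U1] := pselect (exists2 u : triv, u != 0 & U u); [right|left].
  apply/seteqP; split=> // v _; rewrite -[v]addr0 -[v](divfK u0).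
  exact: (Ulin (v / u) u 0).
apply/seteqP; split=> [v Uv|v ->] //.
by apply/eqP; apply: contrapT => /negP v0; apply: U1; exists v.
Qed.

Lemma mod_iso_trivial_twist : mod_iso (twist triv) triv.
Proof. by exists (@Sl3Hom R (twist triv) triv idfun (fun _ _ => erefl)); exists id. Qed.

(** Unlike membership in category O, this part of the membership in the principal
    block passes to extensions, which gives it for modules of length 2 and 3. *)
Definition principal_factors (M : sl3Module R) : Prop :=
  forall S : sl3Module R, composition_factor S M -> linked triv S.

Lemma principal_factors_ext (A M B : sl3Module R) (f : sl3Hom A M) (g : sl3Hom M B) :
  short_exact f g -> principal_factors A -> principal_factors B ->
  principal_factors M.
Proof. by move=> fg Af Bf S /(composition_factor_ext fg)[/Af|/Bf]. Qed.

Lemma principal_factors_linked L : linked triv L -> principal_factors L.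
Proof.
move=> tL S SL; have [_ _ Ls Lo] := linked_right tL.
have LS := composition_factor_simple Ls SL.
apply: linked_trans tL (linked_iso Ls Lo _ _ LS); first by case: SL.
exact: in_catO_iso Lo.
Qed.

Lemma linked_triv_twist L : linked triv L -> linked triv (twist L).
Proof.
move=> tL; apply: linked_trans (linked_twist tL); have [ts tO _ _] := linked_right tL.
apply: linked_sym; apply: linked_iso => //; exact: mod_iso_trivial_twist.
Qed.

End TrivialModule.

(** * Polynomials in two variables *)

HB.lock Definition xi (R : realType) (j : 'I_2) : {mpoly R[i][2]} := 'X_j.

HB.lock Definition pd (R : realType) (j : 'I_2) (f : {mpoly R[i][2]}) :
  {mpoly R[i][2]} := f^`M(j).

HB.lock Definition euler (R : realType) (f : {mpoly R[i][2]}) : {mpoly R[i][2]} :=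
  \sum_j xi R j * pd j f.

Section Polynomials.
Variable R : realType.
Local Notation P := {mpoly R[i][2]}.
Implicit Types (f g : P).

Local Notation xi := (@xi R).
Local Notation pd := (@pd R).

Lemma xiE j : xi j = 'X_j.
Proof. by rewrite xi.unlock. Qed.

Lemma pd_linear j : linear (pd j).
Proof. by move=> c f g; rewrite pd.unlock linearP. Qed.
HB.instance Definition _ j := GRing.isLinear.Build R[i] P P *:%R (pd j) (pd_linear j).

Lemma pdM j f g : pd j (f * g) = pd j f * g + f * pd j g.
Proof. by rewrite pd.unlock mderivM. Qed.

Lemma pd_xi j k : pd j (xi k) = (j == k)%:R.
Proof.
rewrite pd.unlock xi.unlock mderivX mnm1E eq_sym.
case: eqP => [->|_]; last by rewrite scale0r.
by rewrite scale1r -mpolyX0; congr 'X_[_]; apply/mnmP => i; rewrite mnmBE subnn mnm0E.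
Qed.

Lemma pd1 j : pd j 1 = 0.
Proof. by rewrite pd.unlock -mpolyC1 mderivC. Qed.

Lemma pd_comm f : pd i1 (pd i0 f) = pd i0 (pd i1 f).
Proof. by rewrite pd.unlock mderiv_comm. Qed.

Lemma eulerE f : euler f = xi i0 * pd i0 f + xi i1 * pd i1 f.
Proof.
rewrite euler.unlock big_ord_recl big_ord1.
by congr (_ + xi _ * pd _ f); apply: val_inj.
Qed.

Lemma euler_linear : linear (@euler R).
Proof.
move=> c f g; rewrite !eulerE !pd_linear !mulrDr -!scalerAr scalerDr.
by rewrite addrACA.
Qed.
HB.instance Definition _ := GRing.isLinear.Build R[i] P P *:%R (@euler R) euler_linear.

Lemma mpoly_lin_ind (K : P -> Prop) :
    (forall c f g, K f -> K g -> K (c *: f + g)) -> K 0 ->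
    (forall m, K 'X_[m]) -> forall f, K f.
Proof. by move=> Klin K0 KX f; elim/mpolyind: f => // c m f _ _ Kf; apply: Klin. Qed.

Lemma mpoly_xi_ind (K : P -> Prop) :
    (forall c f g, K f -> K g -> K (c *: f + g)) -> K 1 ->
    (forall j f, K f -> K (xi j * f)) -> forall f, K f.
Proof.
move=> Klin K1 Kxi; apply: mpoly_lin_ind => // [|m].
  by rewrite -[0](subrr 1) addrC -scaleN1r; apply: Klin.
elim: {m}(mdeg m) {-2}m (erefl (mdeg m)) => [|n IH] m mn.
  by have /eqP := mn; rewrite mdeg_eq0 => /eqP ->; rewrite mpolyX0.
have [j mj] : exists j, (0 < m j)%N.
  apply: contrapT => /forallNP m0; move: mn; rewrite mdegE big1 // => j _.
  by apply/eqP; rewrite -leqn0 leqNgt; apply/negP/m0.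
have Em : (U_(j) + (m - U_(j)))%MM = m.
  apply/mnmP => k; rewrite mnmDE mnmBE mnm1E.
  by have [<-|_] := eqVneq j k; [rewrite subnKC|rewrite subn0].
rewrite -Em mpolyXD -xiE; apply/Kxi/IH.
by apply/eqP; rewrite -eqSS -mn -[in X in _ == X]Em mdegD mdeg1.
Qed.

Lemma coef_xi_pd j f m : (xi j * pd j f)@_m = f@_m *+ m j.
Proof.
rewrite xi.unlock pd.unlock; elim/mpoly_lin_ind: f => [c f g Ef Eg||n].
- by rewrite linearP mulrDr -scalerAr !linearP /= Ef Eg mulrnDl -mulrnAr.
- by rewrite linear0 mulr0 mcoeff0 mul0rn.
have [nj|nj] := posnP (n j).
  rewrite mderivX nj scale0r mulr0 mcoeff0 mcoeffX.
  by have [<-|_] := eqVneq n m; rewrite ?nj ?mulr0n ?mul0rn.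
rewrite mderivX -scalerAr -mpolyXD mcoeffZ.
have -> : (U_(j) + (n - U_(j)))%MM = n.
  apply/mnmP => k; rewrite mnmDE mnmBE mnm1E.
  by have [<-|_] := eqVneq j k; [rewrite subnKC|rewrite subn0].
rewrite mcoeffX; have [<-|_] := eqVneq n m; last by rewrite mulr0 mul0rn.
by rewrite mulr1.
Qed.

Lemma coef_euler f m : (euler f)@_m = f@_m *+ mdeg m.
Proof.
rewrite eulerE mcoeffD !coef_xi_pd -mulrnDr mdegE big_ord_recl big_ord1.
by congr (_ *+ (_ + m _)); apply: val_inj.
Qed.

Lemma mpoly_eq0 f : (forall m, f@_m = 0) -> f = 0.
Proof. by move=> f0; apply/mpolyP => m; rewrite f0 mcoeff0. Qed.

Lemma mulrn_char0 (a : R[i]) n : a *+ n.+1 = 0 -> a = 0.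
Proof. by move/eqP; rewrite mulrn_eq0 /= => /eqP. Qed.

(** The operator is diagonal on monomials, with positive integers as
    eigenvalues. *)
Lemma euler_inj d f : euler f + f *+ d.+1 = 0 -> f = 0.
Proof.
move=> E; apply: mpoly_eq0 => m; apply: (@mulrn_char0 _ (mdeg m + d)).
by rewrite -addnS mulrnDr -coef_euler -mcoeffMn -mcoeffD E mcoeff0.
Qed.

Lemma euler_ker f : euler f = 0 -> f = (f@_0%MM)%:MP.
Proof.
move=> E; apply/mpolyP => m; rewrite mcoeffC; have [->|m0] := eqVneq m 0%MM.
  by rewrite mulr1.
rewrite mulr0; have := coef_euler f m; rewrite E mcoeff0.
by rewrite -mdeg_eq0 -lt0n in m0; rewrite -(prednK m0) => /esym/mulrn_char0.
Qed.

Lemma pd_ker f : (forall j, pd j f = 0) -> f = (f@_0%MM)%:MP.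
Proof. by move=> df; apply: euler_ker; rewrite eulerE !df !mulr0 addr0. Qed.

Lemma xi_pd_inj j f : f + xi j * pd j f = 0 -> f = 0.
Proof.
move=> E; apply: mpoly_eq0 => m; apply: (@mulrn_char0 _ (m j)).
by rewrite mulrS -coef_xi_pd -mcoeffD E mcoeff0.
Qed.

Lemma xi_neq0 j : xi j != 0.
Proof. by rewrite xi.unlock -msize_poly_eq0 msizeX. Qed.

Lemma xi_mul_eq0 j f : xi j * f = 0 -> f = 0.
Proof. by move=> E; apply: (mulfI (xi_neq0 j)); rewrite E mulr0. Qed.

Lemma coef0_xi j f : (xi j * f)@_0%MM = 0.
Proof.
by rewrite (rmorphM (mcoeff 0%MM)) /= xi.unlock mcoeffX -mdeg_eq0 mdeg1 mul0r.
Qed.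

Lemma mpoly_split j f : exists g r, f = xi j * g + r /\ pd j r = 0.
Proof.
elim/mpoly_xi_ind: f => [c _ _ [g [r [-> r0]]] [g' [r' [-> r'0]]]||k f [g [r [-> r0]]]].
- exists (c *: g + g'), (c *: r + r'); split; last first.
    by rewrite linearP /= r0 r'0 scaler0 addr0.
  by rewrite -!mul_mpolyC; ring.
- by exists 0, 1; split; rewrite ?pd1 // mulr0 add0r.
have [->|kj] := eqVneq k j.
  by exists (xi j * g + r), 0; rewrite linear0 addr0.
exists (xi k * g), (xi k * r); split; first by ring.
by rewrite pdM r0 mulr0 addr0 pd_xi eq_sym (negPf kj) mul0r.
Qed.

(** Exactness of the Koszul complex of the two variables in the middle. *)
Lemma koszul f g : xi i1 * f = xi i0 * g ->
  exists h, f = xi i0 * h /\ g = xi i1 * h.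
Proof.
have [h [r [-> r0]]] := mpoly_split i0 f => E.
have {}E : xi i1 * r = xi i0 * (g - xi i1 * h) by rewrite mulrBr -E; ring.
have gh : g - xi i1 * h = 0.
  apply: (@xi_pd_inj i0); have := congr1 (pd i0) E.
  by rewrite !pdM r0 !pd_xi /= mul0r mul1r mulr0 addr0 => <-.
have r00 : r = 0.
  by apply: (mulfI (xi_neq0 i1)); rewrite E gh !mulr0.
by exists h; rewrite r00 addr0; split=> //; apply/eqP; rewrite -subr_eq0 gh.
Qed.

Lemma aug_decomp f : f@_0%MM = 0 -> exists a b, f = xi i0 * a + xi i1 * b.
Proof.
suff [a [b ->]] : exists a b, f = xi i0 * a + xi i1 * b + (f@_0%MM)%:MP.
  rewrite !mcoeffD !coef0_xi mcoeffC eqxx mulr1 !add0r => ->.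
  by exists a, b; rewrite addr0.
elim/mpoly_xi_ind: f => [c f g [a [b {1}->]] [a' [b' {1}->]]||j f _].
- exists (c *: a + a'), (c *: b + b'); rewrite mcoeffD mcoeffZ.
  by rewrite rmorphD rmorphM -!mul_mpolyC /=; ring.
- by exists 0, 0; rewrite mcoeff1 eqxx !mulr0 !add0r mpolyC1.
suff [a [b E]] : exists a b, xi j * f = xi i0 * a + xi i1 * b.
  by exists a, b; rewrite coef0_xi mpolyC0 addr0.
have [->|] := eqVneq j i0; first by exists f, 0; rewrite mulr0 addr0.
case: j => [[|[|//]] jlt] // _; exists 0, f.
by rewrite mulr0 add0r; congr (xi _ * _); apply: val_inj.
Qed.

Lemma msize_pd j f : (msize (pd j f) <= (msize f).-1)%N.
Proof.
rewrite pd.unlock msizeE; apply/bigmax_leqP_seq => m.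
rewrite mcoeff_msupp mcoeff_deriv => fm _.
have /msize_mdeg_lt : (m + U_(j))%MM \in msupp f.
  by rewrite mcoeff_msupp; apply: contra_neq fm => ->; rewrite mul0rn.
by rewrite mdegD mdeg1 addn1; case: (msize f).
Qed.

Lemma msize_xi j n f : (msize f <= n)%N -> (msize (xi j * f) <= n.+1)%N.
Proof.
have [->|f0] := eqVneq f 0; first by rewrite mulr0 msize0.
by rewrite msizeM ?xi_neq0 // xi.unlock msizeX mdeg1.
Qed.

Lemma msizeD n f g : (msize f <= n)%N -> (msize g <= n)%N -> (msize (f + g) <= n)%N.
Proof.
by move=> fn gn; apply: leq_trans (mmeasureD_le _ _ _) _; rewrite geq_max fn gn. Qed.

Lemma msizeMn n f d : (msize f <= n)%N -> (msize (f *+ d) <= n)%N.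
Proof.
move=> fn; elim: d => [|d IH]; first by rewrite mulr0n msize0.
by rewrite mulrS; apply: msizeD.
Qed.

Lemma msize_xi_pd j k n f : (msize f <= n)%N -> (msize (xi j * pd k f) <= n)%N.
Proof.
case: n => [|n] fn.
  by move: fn; rewrite leqn0 msize_poly_eq0 => /eqP ->; rewrite linear0 mulr0 msize0.
apply/msize_xi/(leq_trans (msize_pd _ _)).
by case: (msize f) fn.
Qed.

Lemma msize_pd_le j n f : (msize f <= n)%N -> (msize (pd j f) <= n)%N.
Proof. by move=> fn; apply: leq_trans (msize_pd _ _) (leq_trans (leq_pred _) fn). Qed.

Lemma msize_euler n f : (msize f <= n)%N -> (msize (euler f) <= n)%N.
Proof. by move=> fn; rewrite eulerE; apply: msizeD; apply: msize_xi_pd. Qed.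

End Polynomials.

(** * Modules given by operators for the matrix units *)

Lemma sl3_mxP (R : realType) c (x y : sl3 R) i j :
  sl3_mx (c *: x + y) i j = c * x i j + y i j.
Proof.
have -> : sl3_mx (c *: x + y) = c *: sl3_mx x + sl3_mx y by exact: (linearP val).
by rewrite !mxE.
Qed.

Section GlModule.
Variables (R : realType) (V : lmodType R[i]) (D : 'I_3 -> 'I_3 -> V -> V).

Definition gl3_relations : Prop := forall i j k l v,
  D i j (D k l v) - D k l (D i j v) =
    (j == k)%:R *: D i l v - (l == i)%:R *: D k j v.

Hypotheses (D_lin : forall i j, linear (D i j)) (D_rel : gl3_relations).

Definition gl_act (x : sl3 R) (v : V) : V :=
  \sum_(p : 'I_3 * 'I_3) x p.1 p.2 *: D p.1 p.2 v.

Lemma gl_act_linearl v : linear (gl_act^~ v).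
Proof.
move=> c x y; rewrite /gl_act scaler_sumr -big_split; apply: eq_bigr => p _ /=.
by rewrite sl3_mxP scalerDl scalerA.
Qed.

Lemma gl_act_linearr x : linear (gl_act x).
Proof.
move=> c u v; rewrite /gl_act scaler_sumr -big_split; apply: eq_bigr => p _ /=.
by rewrite D_lin scalerDr !scalerA mulrC.
Qed.

Lemma gl_act_comp x y v : gl_act x (gl_act y v) =
  \sum_p \sum_q (x p.1 p.2 * y q.1 q.2) *: D p.1 p.2 (D q.1 q.2 v).
Proof.
have D_sum i j (F : 'I_3 * 'I_3 -> V) : D i j (\sum_q F q) = \sum_q D i j (F q).
  exact: (linear_sum (linear_pack (D_lin i j))).
have DZ i j c u : D i j (c *: u) = c *: D i j u.
  exact: (linearZ_LR (linear_pack (D_lin i j))).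
apply: eq_bigr => p _; rewrite D_sum scaler_sumr.
by apply: eq_bigr => q _; rewrite DZ scalerA.
Qed.

(** The operators for the matrix units multiply like the matrix units under the
    first of the two terms in [gl3_relations], so this half of the bracket is
    matrix multiplication. *)
Lemma sum_mulmx (x y : 'M[R[i]]_3) v :
  \sum_(p : 'I_3 * 'I_3) \sum_(q : 'I_3 * 'I_3) (x p.1 p.2 * y q.1 q.2) *:
     ((p.2 == q.1)%:R *: D p.1 q.2 v) =
  \sum_(p : 'I_3 * 'I_3) (x *m y) p.1 p.2 *: D p.1 p.2 v.
Proof.
rewrite -(pair_bigA _ (fun i j =>
  \sum_q (x i j * y q.1 q.2) *: ((j == q.1)%:R *: D i q.2 v))).
rewrite -[RHS](pair_bigA _ (fun i j => (x *m y) i j *: D i j v)).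
apply: eq_bigr => i _ /=.
under [RHS]eq_bigr => l _ do rewrite mxE scaler_suml.
rewrite [RHS]exchange_big; apply: eq_bigr => j _ /=.
rewrite -(pair_bigA _ (fun k l => (x i j * y k l) *: ((j == k)%:R *: D i l v))) /=.
rewrite (bigD1 j) //= [X in _ + X]big1 ?addr0 => [|k /negPf kj]; last first.
  by rewrite big1 // => l _; rewrite eq_sym kj scale0r scaler0.
by apply: eq_bigr => l _; rewrite eqxx scale1r.
Qed.

Lemma gl_act_bracket x y v :
  gl_act (sl3_bracket x y) v = gl_act x (gl_act y v) - gl_act y (gl_act x v).
Proof.
rewrite !gl_act_comp [X in _ - X]exchange_big /= -sumrB.
have -> : \sum_(p : 'I_3 * 'I_3)
   (\sum_q (x p.1 p.2 * y q.1 q.2) *: D p.1 p.2 (D q.1 q.2 v) -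
    \sum_q (y q.1 q.2 * x p.1 p.2) *: D q.1 q.2 (D p.1 p.2 v)) =
   \sum_(p : 'I_3 * 'I_3) \sum_q (x p.1 p.2 * y q.1 q.2) *:
     ((p.2 == q.1)%:R *: D p.1 q.2 v) -
   \sum_(q : 'I_3 * 'I_3) \sum_p (y q.1 q.2 * x p.1 p.2) *:
     ((q.2 == p.1)%:R *: D q.1 p.2 v).
  rewrite [X in _ - X]exchange_big /= -sumrB; apply: eq_bigr => p _.
  rewrite -!sumrB; apply: eq_bigr => q _.
  by rewrite [y _ _ * _]mulrC -!scalerBr D_rel.
rewrite !sum_mulmx -sumrB; apply: eq_bigr => p _.
by rewrite -scalerBl !mxE.
Qed.

Definition gl_module : sl3Module R :=
  Sl3Module gl_act_linearl gl_act_linearr gl_act_bracket.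

Lemma gl_act_unit i j (v : gl_module) : i != j -> lie_act (Eu R i j) v = D i j v.
Proof.
move=> ij; rewrite /= /gl_act (bigD1 (i, j)) //= big1 => [|[k l]].
  by rewrite !EuE !eqxx (negPf ij) mul0r mul0r subr0 scale1r addr0.
rewrite xpair_eqE => /negPf kl; rewrite EuE kl (negPf ij).
by rewrite mul0r mul0r subr0 scale0r.
Qed.

Lemma gl_act_cartan h (v : gl_module) : cartan h ->
  lie_act h v = \sum_i h i i *: D i i v.
Proof.
move=> /is_diag_mxP hd; rewrite -[LHS](pair_bigA _ (fun i j => h i j *: D i j v)) /=.
apply: eq_bigr => i _; rewrite (bigD1 i) //= big1 ?addr0 // => j ji.
by rewrite hd ?scale0r // eq_sym.
Qed.

End GlModule.

Section GlHom.
Variables (R : realType) (V W : lmodType R[i]).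
Variables (D : 'I_3 -> 'I_3 -> V -> V) (D' : 'I_3 -> 'I_3 -> W -> W).
Hypotheses (D_lin : forall i j, linear (D i j)) (D_rel : gl3_relations D).
Hypotheses (D'_lin : forall i j, linear (D' i j)) (D'_rel : gl3_relations D').

(** The scalar [c] accounts for the difference of the central characters of
    gl3, which sl3 does not see. *)
Lemma gl_hom (f : {linear V -> W}) (c : R[i]) v :
    (forall i j, f (D i j v) = D' i j (f v) + ((i == j)%:R * c) *: f v) ->
  forall x, f (@lie_act R (gl_module D_lin D_rel) x v) =
            @lie_act R (gl_module D'_lin D'_rel) x (f v).
Proof.
move=> fD x; rewrite /= /gl_act linear_sum.
under eq_bigr => p _ do rewrite linearZ /= fD scalerDr scalerA.
rewrite big_split /= -[RHS]addr0; congr (_ + _).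
rewrite -scaler_suml; apply/eqP; rewrite scaler_eq0; apply/orP; left; apply/eqP.
rewrite -(pair_bigA _ (fun i j => x i j * ((i == j)%:R * c))) /=.
transitivity (\sum_i x i i * c); last by rewrite -mulr_suml sl3_tr mul0r.
apply: eq_bigr => i _.
rewrite (bigD1 i) //= eqxx mul1r big1 ?addr0 // => j /negPf ji.
by rewrite eq_sym ji mul0r mulr0.
Qed.
End GlHom.

(** * Operator identities in the Weyl algebra *)

Definition o0 : 'I_3 := @Ordinal 3 0 isT.
Definition o1 : 'I_3 := @Ordinal 3 1 isT.
Definition o2 : 'I_3 := @Ordinal 3 2 isT.

Lemma ord3_ind (Q : 'I_3 -> Prop) : Q o0 -> Q o1 -> Q o2 -> forall i, Q i.
Proof.
move=> Q0 Q1 Q2 [[|[|[|//]]] ilt].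
- by rewrite (_ : Ordinal ilt = o0) //; apply: val_inj.
- by rewrite (_ : Ordinal ilt = o1) //; apply: val_inj.
- by rewrite (_ : Ordinal ilt = o2) //; apply: val_inj.
Qed.

Section WeylCalculus.
Variables (K : comNzRingType) (P : comAlgType K) (x0 x1 : P).
Variables p0 p1 : {linear P -> P}.
Hypotheses (p0M : forall f g, p0 (f * g) = p0 f * g + f * p0 g)
  (p1M : forall f g, p1 (f * g) = p1 f * g + f * p1 g)
  (p00 : p0 x0 = 1) (p01 : p0 x1 = 0) (p10 : p1 x0 = 0) (p11 : p1 x1 = 1)
  (p_comm : forall f, p1 (p0 f) = p0 (p1 f)).
Implicit Types (f g : P) (d : nat).

Let p0D f g : p0 (f + g) = p0 f + p0 g. Proof. exact: linearD. Qed.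
Let p1D f g : p1 (f + g) = p1 f + p1 g. Proof. exact: linearD. Qed.
Let p0N f : p0 (- f) = - p0 f. Proof. exact: linearN. Qed.
Let p1N f : p1 (- f) = - p1 f. Proof. exact: linearN. Qed.
Let p0Mn f n : p0 (f *+ n) = p0 f *+ n. Proof. exact: linearMn. Qed.
Let p1Mn f n : p1 (f *+ n) = p1 f *+ n. Proof. exact: linearMn. Qed.
Let p0_1 : p0 1 = 0.
Proof. by apply: (addIr (p0 1)); rewrite add0r -{3}[1]mulr1 p0M mulr1 mul1r. Qed.
Let p1_1 : p1 1 = 0.
Proof. by apply: (addIr (p1 1)); rewrite add0r -{3}[1]mulr1 p1M mulr1 mul1r. Qed.
Let p0_0 : p0 0 = 0. Proof. exact: linear0. Qed.
Let p1_0 : p1 0 = 0. Proof. exact: linear0. Qed.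
Let pE := (p0_0, p1_0, p0_1, p1_1, p0D, p1D, p0N, p1N, p0Mn,
  p1Mn, p0M, p1M, p00, p01, p10, p11, p_comm).

Definition opX (i : 'I_3) f : P :=
  match val i with 0 => p0 f | 1 => p1 f | _ => f end.

Definition opY d (j : 'I_3) f : P :=
  match val j with
  | 0 => - (x0 * f) | 1 => - (x1 * f) | _ => x0 * p0 f + x1 * p1 f + f *+ d end.

(** On functions of z_0, z_1, z_2 that are homogeneous of degree - d, the vector
    fields - z_j d/dz_i represent gl3. Normalize these functions such that
    d/dz_2 becomes the identity, and let x0, x1 be the two remaining coordinates.
    Then Euler's relation turns - z_2 into the Euler operator plus d, and
    - z_j d/dz_i becomes the product of [opX i] and [opY d j]. In this form the
    action makes sense on polynomials. *)
Definition opD d (i j : 'I_3) f : P := opY d j (opX i f).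

Lemma opX_linear i : linear (opX i).
Proof. by elim/ord3_ind: i => c f g; rewrite /opX /= ?linearP. Qed.

Lemma opY_linear d j : linear (opY d j).
Proof.
elim/ord3_ind: j => c f g; rewrite /opY /=.
- by rewrite mulrDr -scalerAr opprD scalerN.
- by rewrite mulrDr -scalerAr opprD scalerN.
- rewrite !linearP /= !mulrDr -!scalerAr mulrnDl scalerMnr.
  by rewrite [X in X + _ = _]addrACA -!scalerDr [LHS]addrACA -scalerDr.
Qed.

Lemma opD_linear d i j : linear (opD d i j).
Proof. by move=> c f g; rewrite /opD opX_linear opY_linear. Qed.

Lemma opD_relations d i j k l f : opD d i j (opD d k l f) - opD d k l (opD d i j f) =
  (j == k)%:R *: opD d i l f - (l == i)%:R *: opD d k j f.
Proof.
rewrite -!val_eqE !scaler_nat.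
elim/ord3_ind: i; elim/ord3_ind: j; elim/ord3_ind: k; elim/ord3_ind: l;
by rewrite /opD /opX /opY /= ?mulr1n ?mulr0n ?pE; ring.
Qed.

Let scale_natE n g : (n%:R : K) *: g = n%:R * g.
Proof. by rewrite scaler_nat mulr_natl. Qed.

(** The action on the tensor product of the module with d = 2 and the natural
    representation, whose elements are triples of polynomials. *)
Definition opM (i j : 'I_3) (F : 'I_3 -> P) (k : 'I_3) : P :=
  opD 2 i j (F k) + (k == i)%:R * F j.

Definition sumX (F : 'I_3 -> P) : P := p0 (F o0) + p1 (F o1) + F o2.

Definition tupY (g : P) (k : 'I_3) : P := opY 2 k g.

(** With [tupY], the beginning of a Koszul complex: [curl] kills [tupY g], as the
    first two components of the latter are - x0 g and - x1 g. *)
Definition curl (F : 'I_3 -> P) : P := x1 * F o0 - x0 * F o1.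

Lemma opM_relations i j k l F m : opM i j (opM k l F) m - opM k l (opM i j F) m =
  (j == k)%:R *: opM i l F m - (l == i)%:R *: opM k j F m.
Proof.
have DE : opD 2 i j (opD 2 k l (F m)) = opD 2 k l (opD 2 i j (F m)) +
    (j == k)%:R * opD 2 i l (F m) - (l == i)%:R * opD 2 k j (F m).
  have := opD_relations 2 i j k l (F m); rewrite !scale_natE => /eqP.
  by rewrite subr_eq => /eqP ->; ring.
have D_add i' j' f (b : bool) g :
    opD 2 i' j' (f + b%:R * g) = opD 2 i' j' f + b%:R * opD 2 i' j' g.
  by rewrite addrC -scale_natE opD_linear scale_natE addrC.
by rewrite /opM !D_add DE !scale_natE; ring.
Qed.

Lemma sumX_opM i j F : sumX (opM i j F) = opD 3 i j (sumX F).
Proof.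
rewrite /sumX /opM -!val_eqE; elim/ord3_ind: i; elim/ord3_ind: j;
by rewrite /opD /opX /opY /= ?mulr1n ?mulr0n ?mul0r ?mul1r ?pE; ring.
Qed.

Lemma opM_tupY i j g k : tupY (opD 3 i j g) k = opM i j (tupY g) k.
Proof.
rewrite /tupY /opM -!val_eqE.
elim/ord3_ind: i; elim/ord3_ind: j; elim/ord3_ind: k;
by rewrite /opD /opX /opY /= ?mulr1n ?mulr0n ?mul0r ?mul1r ?pE; ring.
Qed.

(** The terms d0 (x0 g) + d1 (x1 g) are the Euler operator plus 2 applied to g;
    this is what singles out d = 2 for the first factor of the tensor product. *)
Lemma sumX_tupY g : sumX (tupY g) = 0.
Proof. by rewrite /sumX /tupY /opY /= ?pE; ring. Qed.

(** The action of E_02 and E_12 on the first two components involves the third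
    one, which the hypothesis expresses in terms of the others. The last term is
    the shift of the trace: the centre of gl3 acts by 3 on triples, and by 0 on
    the module with d = 0. *)
Lemma curl_opM i j F : sumX F = 0 ->
  curl (opM i j F) = opD 0 i j (curl F) + (i == j)%:R * curl F.
Proof.
move=> /eqP; rewrite /sumX addrC addr_eq0 => /eqP F2.
rewrite /curl /opM -!val_eqE; elim/ord3_ind: i; elim/ord3_ind: j;
by rewrite /opD /opX /opY /= ?mulr1n ?mulr0n ?mul0r ?mul1r ?F2 ?pE; ring.
Qed.

End WeylCalculus.

(** * The polynomial modules *)

Section Models.
Variable R : realType.
Local Notation P := {mpoly R[i][2]}.
Local Notation pd := (@pd R).
Local Notation xi := (@xi R).
Implicit Types (f g : P) (d : nat).

Lemma pd_xi00 : pd i0 (xi i0) = 1. Proof. by rewrite pd_xi. Qed.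
Lemma pd_xi01 : pd i0 (xi i1) = 0. Proof. by rewrite pd_xi. Qed.
Lemma pd_xi10 : pd i1 (xi i0) = 0. Proof. by rewrite pd_xi. Qed.
Lemma pd_xi11 : pd i1 (xi i1) = 1. Proof. by rewrite pd_xi. Qed.

Ltac weyl := first [exact: pdM|exact: pd_xi00|exact: pd_xi01|exact: pd_xi10
  |exact: pd_xi11|exact: pd_comm].

Definition vD d : 'I_3 -> 'I_3 -> P -> P :=
  @opD R[i] P (xi i0) (xi i1) (pd i0) (pd i1) d.

Lemma vD_linear d i j : linear (vD d i j).
Proof. exact: opD_linear. Qed.

Lemma vD_relations d : gl3_relations (vD d).
Proof.
by move=> i j k l f; apply: opD_relations; weyl.
Qed.

Definition Vmod d : sl3Module R := gl_module (vD_linear d) (vD_relations d).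

Definition mD (i j : 'I_3) (F : {ffun 'I_3 -> P}) : {ffun 'I_3 -> P} :=
  [ffun k => @opM R[i] P (xi i0) (xi i1) (pd i0) (pd i1) i j F k].

Lemma mD_linear i j : linear (mD i j).
Proof.
move=> c F G; apply/ffunP => k; rewrite !ffunE /opM !ffunE opD_linear.
by rewrite mulrDr -scalerAr scalerDr addrACA.
Qed.

Lemma opM_eq x0 x1 (p0 p1 : {linear P -> P}) i j (F G : 'I_3 -> P) k :
  F =1 G -> @opM R[i] P x0 x1 p0 p1 i j F k = opM x0 x1 p0 p1 i j G k.
Proof. by move=> FG; rewrite /opM !FG. Qed.

Lemma mD_relations : gl3_relations mD.
Proof.
move=> i j k l F; apply/ffunP => m; rewrite !ffunE.
rewrite (opM_eq (xi i0) (xi i1) (pd i0) (pd i1) i j m (ffunE _)).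
rewrite (opM_eq (xi i0) (xi i1) (pd i0) (pd i1) k l m (ffunE _)).
by apply: opM_relations; weyl.
Qed.

Definition Mmod : sl3Module R := gl_module mD_linear mD_relations.

Definition mX (F : {ffun 'I_3 -> P}) : P :=
  @sumX R[i] P (pd i0) (pd i1) (fun k => F k).

Lemma mX_linear : linear mX.
Proof.
move=> c F G; rewrite /mX /sumX !ffunE !linearP /= !scalerDr.
by rewrite [X in X + _ = _]addrACA [LHS]addrACA.
Qed.

Lemma mX_act x F : linear_pack mX_linear (@lie_act R Mmod x F) =
  @lie_act R (Vmod 3) x (linear_pack mX_linear F).
Proof.
apply: (@gl_hom R _ _ _ _ _ _ _ _ _ 0) => i j; rewrite mulr0 scale0r addr0.
transitivity (@sumX R[i] P (pd i0) (pd i1)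
    (@opM R[i] P (xi i0) (xi i1) (pd i0) (pd i1) i j (fun k => F k))).
  by rewrite /= /mX /sumX !ffunE.
by apply: sumX_opM; weyl.
Qed.

Definition homX : sl3Hom Mmod (Vmod 3) := @Sl3Hom R Mmod (Vmod 3) _ mX_act.

Definition Nmod : sl3Module R := submodM (ker_submodule homX).

Definition inclN : sl3Hom Nmod Mmod := submod_incl (ker_submodule homX).

Lemma homXE (F : Mmod) : homX F = pd i0 (F o0) + pd i1 (F o1) + F o2.
Proof. by []. Qed.

Lemma exact_N_M_V : short_exact inclN homX.
Proof.
apply/short_exactP; split=> [a|a|m|b].
- by rewrite -(linear0 inclN) => /submod_incl_inj.
- exact: (submod_incl_mem (subU := ker_submodule homX)).
- exact: (submod_inclP (ker_submodule homX)).
exists [ffun k => if k == o2 then b else 0].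
by rewrite homXE !ffunE /= !linear0 !add0r.
Qed.

Definition mY (g : P) : {ffun 'I_3 -> P} :=
  [ffun k => tupY (xi i0) (xi i1) (pd i0) (pd i1) g k].

Lemma mY_linear : linear mY.
Proof. by move=> c f g; apply/ffunP => k; rewrite !ffunE /tupY opY_linear. Qed.

Lemma mY_act x g : linear_pack mY_linear (@lie_act R (Vmod 3) x g) =
  @lie_act R Mmod x (linear_pack mY_linear g).
Proof.
apply: (@gl_hom R _ _ _ _ _ _ _ _ _ 0) => i j; rewrite mulr0 scale0r addr0.
apply/ffunP => k; rewrite !ffunE (opM_eq _ _ _ _ _ _ _ (ffunE _)).
by apply: opM_tupY; weyl.
Qed.

Lemma mX_mY g : mX (mY g) = 0.
Proof.
rewrite /mX /mY /sumX !ffunE.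
by apply: (@sumX_tupY R[i] P (xi i0) (xi i1) (pd i0) (pd i1)); weyl.
Qed.

Lemma coef0_act0 x (f : Vmod 0) : (lie_act x f : P)@_0%MM = 0.
Proof.
rewrite /= /gl_act linear_sum big1 // => p _ /=.
rewrite mcoeffZ /vD /opD; elim/ord3_ind: p.2; rewrite /opY /= ?mcoeffN ?coef0_xi.
- by rewrite oppr0 mulr0.
- by rewrite oppr0 mulr0.
by rewrite addr0 mcoeffD !coef0_xi addr0 mulr0.
Qed.

Lemma aug_submodule : submodule [set f : Vmod 0 | f@_0%MM = 0].
Proof.
split=> [|c f g /= f0 g0|x f _ _]; first by rewrite /= mcoeff0.
  by rewrite mcoeffD mcoeffZ f0 g0 mulr0 addr0.
exact: coef0_act0.
Qed.

Definition Imod : sl3Module R := submodM aug_submodule.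

Definition inclI : sl3Hom Imod (Vmod 0) := submod_incl aug_submodule.

Definition mC (F : {ffun 'I_3 -> P}) : P := @curl R[i] P (xi i0) (xi i1) (fun k => F k).

Lemma mC_aug F : (mC F)@_0%MM = 0.
Proof. by rewrite mcoeffB !coef0_xi subr0. Qed.

Lemma mC_linear : linear mC.
Proof.
move=> c F G; rewrite /mC /curl !ffunE !mulrDr -!scalerAr scalerBr opprD.
by rewrite addrACA.
Qed.

Lemma mC_act x (F : {ffun 'I_3 -> P}) : mX F = 0 ->
  linear_pack mC_linear (@lie_act R Mmod x F) =
  @lie_act R (Vmod 0) x (linear_pack mC_linear F).
Proof.
move=> F0; apply: (@gl_hom R _ _ _ _ _ _ _ _ _ 1) => i j.
transitivity (@curl R[i] P (xi i0) (xi i1)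
    (@opM R[i] P (xi i0) (xi i1) (pd i0) (pd i1) i j (fun k => F k))).
  by rewrite /= /mC /curl !ffunE.
have -> : ((i == j)%:R * 1) *: linear_pack mC_linear F =
          (i == j)%:R * mC F.
  by rewrite mulr1 scaler_nat mulr_natl.
by apply: curl_opM; first [exact: F0|weyl].
Qed.

Lemma homC_subproof : exists h : sl3Hom Nmod Imod,
  forall u, inclI (h u) = mC (inclN u).
Proof.
pose f : {linear Nmod -> Vmod 0} := linear_pack mC_linear \o inclN.
have f_act x u : f (lie_act x u) = @lie_act R (Vmod 0) x (f u).
  exact: (mC_act x (submod_incl_mem u)).
have [h hE] := @hom_lift R Imod (Vmod 0) Nmod inclI (@Sl3Hom R Nmod (Vmod 0) f f_act)
  (@submod_incl_inj _ _ _ _) (fun u => submod_inclP aug_submodule (mC_aug _)).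
by exists h.
Qed.

Definition homC : sl3Hom Nmod Imod := projT1 (cid homC_subproof).

Lemma homCE u : inclI (homC u) = xi i1 * inclN u o0 - xi i0 * inclN u o1.
Proof. by rewrite [LHS](projT2 (cid homC_subproof)). Qed.

Lemma homY_subproof : exists h : sl3Hom (Vmod 3) Nmod,
  forall g, inclN (h g) = mY g.
Proof.
have [h hE] := @hom_lift R Nmod Mmod (Vmod 3) inclN (@Sl3Hom R (Vmod 3) Mmod _ mY_act)
  (@submod_incl_inj _ _ _ _) (fun g => submod_inclP (ker_submodule homX) (mX_mY g)).
by exists h.
Qed.

Definition homY : sl3Hom (Vmod 3) Nmod := projT1 (cid homY_subproof).

Lemma homYE g : inclN (homY g) = mY g.
Proof. exact: (projT2 (cid homY_subproof)). Qed.

Lemma Nmod_third (u : Nmod) :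
  inclN u o2 = - (pd i0 (inclN u o0) + pd i1 (inclN u o1)).
Proof.
have := submod_incl_mem u; rewrite /= -/inclN [LHS]addrC => /eqP.
by rewrite addr_eq0 => /eqP.
Qed.

(** An element of N is determined by its first two components, which are
    arbitrary by [Nmod_mk]: N is free of rank 2 over the polynomials. *)
Lemma Nmod_ext (u v : Nmod) :
  inclN u o0 = inclN v o0 -> inclN u o1 = inclN v o1 -> u = v.
Proof.
move=> uv0 uv1; apply: (@submod_incl_inj _ _ _ (ker_submodule homX)).
apply/ffunP; elim/ord3_ind => //.
by rewrite -!/inclN !Nmod_third uv0 uv1.
Qed.

Lemma Nmod_mk (f g : P) : exists u : Nmod, inclN u o0 = f /\ inclN u o1 = g.
Proof.
pose F : Mmod := [ffun k => if k == o0 then f else if k == o1 then g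
                    else - (pd i0 f + pd i1 g)].
have [|u uF] := submod_inclP (ker_submodule homX) (v := F).
  by rewrite /= /mX /sumX !ffunE /= subrr.
by exists u; rewrite -!/inclN [inclN u]uF !ffunE.
Qed.

(** Exactness in the middle is [koszul], surjectivity is [aug_decomp]. *)
Lemma exact_V_N_I : short_exact homY homC.
Proof.
apply/short_exactP; split=> [g|g|u|a].
- move=> /(congr1 inclN); rewrite homYE linear0 => /ffunP/(_ o0).
  rewrite !ffunE /tupY /opY /= => /eqP; rewrite oppr_eq0.
  by move=> /eqP/xi_mul_eq0.
- apply: (@submod_incl_inj _ _ _ aug_submodule).
  rewrite -!/inclI homCE homYE linear0 !ffunE /tupY /opY /=.
  by rewrite !mulrN; rewrite mulrCA addrN.
- move=> /(congr1 inclI); rewrite homCE linear0 => /eqP; rewrite subr_eq0 => /eqP.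
  move=> /koszul[h [u0 u1]]; exists (- h); apply: Nmod_ext.
    by rewrite homYE ffunE /tupY /opY /= mulrN opprK.
  by rewrite homYE ffunE /tupY /opY /= mulrN opprK.
have [f [g fg]] := aug_decomp (submod_incl_mem a).
have [u [u0 u1]] := Nmod_mk g (- f); exists u.
apply: (@submod_incl_inj _ _ _ aug_submodule); rewrite -!/inclI homCE u0 u1.
by rewrite [RHS]fg mulrN opprK addrC.
Qed.

End Models.

(** * Membership in category O *)

Section PolynomialCategoryO.
Variable R : realType.
Local Notation P := {mpoly R[i][2]}.
Local Notation xi := (@xi R).
Local Notation Vmod := (@Vmod R).
Local Notation Mmod := (@Mmod R).
Local Notation vD := (@vD R).

Lemma lie_act_units (M : sl3Module R) x (w : M) :
  lie_act x w = \sum_i \sum_j x i j *: lie_act (Eu R i j) w.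
Proof.
have suml (F : 'I_3 -> sl3 R) : lie_act (\sum_i F i) w = \sum_i lie_act (F i) w.
  exact: (linear_sum (linear_pack (lie_act_linearl w))).
rewrite {1}(unit_span x) suml; apply: eq_bigr => i _; rewrite suml.
by apply: eq_bigr => j _; rewrite lie_actZl.
Qed.

Lemma nplus_stable (M : sl3Module R) (U : set M) : lin_subspace U ->
    (forall (i j : 'I_3) w, (i < j)%N -> U w -> U (lie_act (Eu R i j) w)) ->
  stable_subspace (@nplus R) U.
Proof.
move=> Ul UE; have [U0 Ulin _] := Ul; split=> // x w xn Uw.
rewrite lie_act_units; apply: (stable_sum _ Ul) => i _.
apply: (stable_sum _ Ul) => j _; have [ji|ij] := leqP j i.
  by rewrite xn // scale0r.
by apply: (stableZ _ Ul); apply: UE.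
Qed.

(** W is a finite sum of images of the polynomial ring. The monomials are weight
    vectors, so W is semisimple over the Cartan subalgebra. The raising operators
    do not increase the degree, so a vector generates under n_+ a subspace of the
    span of the finitely many monomials of bounded degree. Finally, W is generated
    by the constants. *)
Lemma poly_catO (W : sl3Module R) k (emb : 'I_k -> {linear P -> W})
    (co : 'I_k -> {linear W -> P}) :
    (forall w, w = \sum_i emb i (co i w)) ->
    (forall i m, exists lam, weight_space lam (emb i 'X_[m])) ->
    (forall n (i j : 'I_3) w, (i < j)%N -> (forall l, msize (co l w) <= n)%N ->
       forall l, (msize (co l (lie_act (Eu R i j) w)) <= n)%N) ->
    (forall U, submodule U -> (forall i, U (emb i 1)) -> forall i f, U (emb i f)) ->
  in_catO W.
Proof.
move=> Wspan Wwt Wfilt Wgen; split.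
- exists [seq emb i 1 | i <- enum 'I_k]; apply/seteqP; split=> // w _.
  have T := smallest_stable setT [set` [seq emb i 1 | i <- enum 'I_k]].
  rewrite (Wspan w); apply: (stable_sum _ T) => i _; apply: Wgen => // l.
  by apply: sub_gen_smallest; apply/mapP; exists l => //; rewrite mem_enum.
- apply/seteqP; split=> // w _.
  set G := \bigcup_lam _; have T := smallest_stable set0 G.
  rewrite (Wspan w); apply: (stable_sum _ T) => i _; rewrite [co i w]mpolyE linear_sum.
  apply: (stable_sum _ T) => m _; rewrite linearZ; apply: (stableZ _ T).
  by apply: sub_gen_smallest; have [lam wlam] := Wwt i m; exists lam.
move=> w; pose n := \max_i msize (co i w).
pose B := [set u | forall i, (msize (co i u) <= n)%N].
have Blin : lin_subspace B.
  split=> // [i|c u v Bu Bv i]; first by rewrite linear0 msize0.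
  by rewrite linearP; apply: msizeD => //; apply: leq_trans (msizeZ_le _ _) _.
pose s := [seq emb p.1 'X_[bmnm p.2] | p <- enum {: 'I_k * 'X_{1..2 < n}}].
exists s => u uw.
have Bu : B u.
  move: u uw; apply: smallest_sub; last by move=> _ -> i; rewrite (leq_bigmax i).
  by apply: nplus_stable => // i j v ij; apply: Wfilt.
have T := smallest_stable set0 [set` s].
rewrite (Wspan u); apply: (stable_sum _ T) => i _; rewrite (mpolywE (Bu i)) linear_sum.
apply: (stable_sum _ T) => m _; rewrite linearZ; apply: (stableZ _ T).
by apply: sub_gen_smallest; apply/mapP; exists (i, m) => //; rewrite mem_enum.
Qed.

(** The weight of a monomial, as a weight of gl3. *)
Definition vwt d (m : 'X_{1..2}) (i : 'I_3) : R[i] :=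
  match val i with 0 => - (m i0)%:R | 1 => - (m i1)%:R | _ => (mdeg m + d)%:R end.

Lemma vD_coef d i f m : (vD d i i f)@_m = vwt d m i * f@_m.
Proof.
rewrite /vD /opD; elim/ord3_ind: i; rewrite /opX /opY /vwt /= ?mcoeffN ?coef_xi_pd.
- by rewrite mulNr mulr_natl.
- by rewrite mulNr mulr_natl.
by rewrite -eulerE mcoeffD mcoeffMn coef_euler -mulrnDr mulr_natl.
Qed.

Lemma vD_monomial d i m : vD d i i 'X_[m] = vwt d m i *: 'X_[m].
Proof.
apply/mpolyP => l; rewrite vD_coef mcoeffZ mcoeffX.
by have [->|_] := eqVneq m l; rewrite ?mulr0.
Qed.

Lemma msize_vD d (i j : 'I_3) (f : P) n : (i < j)%N ->
  (msize f <= n)%N -> (msize (vD d i j f) <= n)%N.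
Proof.
rewrite /vD /opD; elim/ord3_ind: i; elim/ord3_ind: j; rewrite /opX /opY //= => _ fn.
- by rewrite mmeasureN; apply: msize_xi_pd.
- rewrite -eulerE; apply: msizeD; first exact/msize_euler/msize_pd_le.
  exact/msizeMn/msize_pd_le.
- rewrite -eulerE; apply: msizeD; first exact/msize_euler/msize_pd_le.
  exact/msizeMn/msize_pd_le.
Qed.

Lemma gl_weight (V : lmodType R[i]) (D : 'I_3 -> 'I_3 -> V -> V)
    (D_lin : forall i j, linear (D i j)) (D_rel : gl3_relations D) (lam : weight R) v :
  (forall i, D i i v = lam 0 i *: v) ->
  @weight_space R (gl_module D_lin D_rel) lam v.
Proof.
move=> Dv h hc; rewrite gl_act_cartan // /weight_eval scaler_suml.
by apply: eq_bigr => i _; rewrite Dv scalerA mulrC.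
Qed.

Lemma Vmod_lower d (f : Vmod d) (j : 'I_2) : exists x, xi j * f = lie_act x f.
Proof.
case: j => [[|[|//]] jlt].
  exists (- Eu R o2 o0); rewrite lie_actNl gl_act_unit // /vD /opD /opX /opY /= opprK.
  by congr (xi _ * _); apply: val_inj.
exists (- Eu R o2 o1); rewrite lie_actNl gl_act_unit // /vD /opD /opX /opY /= opprK.
by congr (xi _ * _); apply: val_inj.
Qed.

Lemma Vmod_catO d : in_catO (Vmod d).
Proof.
apply: (@poly_catO (Vmod d) 1 (fun=> idfun) (fun=> idfun)).
- by move=> w; rewrite big_ord1.
- move=> _ m; exists (\row_i vwt d m i); apply: gl_weight => i.
  by rewrite vD_monomial mxE.
- move=> n i j w ij wn l; rewrite gl_act_unit; last by rewrite -val_eqE neq_ltn ij.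
  exact: msize_vD (wn l).
move=> U [U0 Ulin Uact] U1 _; apply: (@mpoly_xi_ind R U) => //; first exact: (U1 ord0).
by move=> j f Uf; have [x xf] := @Vmod_lower d f j; rewrite xf; exact: (Uact x f I Uf).
Qed.

Lemma Mmod_catO : in_catO Mmod.
Proof.
pose e (i : 'I_3) (f : P) : Mmod := [ffun k => if k == i then f else 0].
have e_lin i : linear (e i).
  move=> c f g; apply/ffunP => k; rewrite !ffunE.
  by case: ifP; rewrite // scaler0 addr0.
have co_lin (i : 'I_3) : linear (fun F : Mmod => F i).
  by move=> c F G; rewrite !ffunE.
have eE x i (f : P) : x != i -> forall j, lie_act (Eu R x i) (e j f) =
    [ffun k => if k == j then vD 2 x i f else 0] +
    [ffun k => (k == x)%:R * (if i == j then f else 0)].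
  move=> xi' j; rewrite gl_act_unit //; apply/ffunP => k; rewrite !ffunE /opM !ffunE.
  congr (_ + _); case: (k == j) => //.
  exact: (linear0 (linear_pack (@vD_linear R 2 x i))).
apply: (@poly_catO Mmod 3 (fun i => linear_pack (e_lin i))
  (fun i => linear_pack (co_lin i))).
- move=> w; apply/ffunP => k; rewrite sum_ffunE (bigD1 k) //= ffunE eqxx big1 ?addr0 //.
  by move=> i ik; rewrite ffunE eq_sym (negPf ik).
- move=> i m; exists (\row_j (vwt 2 m j + (i == j)%:R)); apply: gl_weight => j.
  apply/ffunP => k; rewrite !ffunE /opM !ffunE mxE.
  case: (eqVneq k i) => [->|ki].
    rewrite -[opD _ _ _ _ _ _ _ _]/(vD 2 j j 'X_[m]) vD_monomial.
    rewrite scalerDl; congr (_ + _); rewrite scaler_nat mulr_natl.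
    by rewrite (eq_sym i j); case: (j == i); rewrite ?mulr0n.
  have vD0 : vD 2 j j 0 = 0 := linear0 (linear_pack (@vD_linear R 2 j j)).
  rewrite scaler0 -[opD _ _ _ _ _ _ _ _]/(vD 2 j j 0) vD0.
  rewrite add0r; case: (eqVneq k j) => [<-|]; last by rewrite mul0r.
  by rewrite (negPf ki) mulr0.
- move=> n i j w ij wn l; rewrite gl_act_unit; last by rewrite -val_eqE neq_ltn ij.
  rewrite /= ffunE /opM; apply: msizeD; first exact: (msize_vD 2 ij (wn l)).
  by rewrite mulr_natl; apply: msizeMn; apply: wn.
move=> U Usub U1; have [U0 Ulin Uact] := Usub.
have U2 f : U (e o2 f).
  move: f; apply: mpoly_xi_ind => [c f g Uf Ug||j f Uf].
  - by rewrite e_lin; apply: Ulin.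
  - exact: U1.
  have [x [xE ->]] : exists x : 'I_3, x != o2 /\ xi j * f = - vD 2 o2 x f.
    case: j => [[|[|//]] jlt].
      by exists o0; split=> //; rewrite opprK; congr (xi _ * _); apply: val_inj.
    by exists o1; split=> //; rewrite opprK; congr (xi _ * _); apply: val_inj.
  have -> : e o2 (- vD 2 o2 x f) = - lie_act (Eu R o2 x) (e o2 f).
    rewrite eE; last by rewrite eq_sym.
    rewrite (negPf xE); apply/ffunP => k; rewrite !ffunE mulr0 addr0.
    by case: ifP; rewrite ?oppr0.
  by rewrite -scaleN1r; apply: (stableZ _ Usub); apply: (Uact _ _ I).
move=> i f; have [->|i2] := eqVneq i o2; first exact: U2.
rewrite -[X in U X]/(e i f); move: f; apply: mpoly_xi_ind => [c f g Uf Ug||j f Uf].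
- by rewrite e_lin; apply: Ulin.
- exact: U1.
have [x [xE ->]] : exists x : 'I_3, x != o2 /\ xi j * f = - vD 2 o2 x f.
  case: j => [[|[|//]] jlt].
    by exists o0; split=> //; rewrite opprK; congr (xi _ * _); apply: val_inj.
  by exists o1; split=> //; rewrite opprK; congr (xi _ * _); apply: val_inj.
have -> : e i (- vD 2 o2 x f) =
    (if x == i then e o2 f else 0) - lie_act (Eu R o2 x) (e i f).
  rewrite eE; last by rewrite eq_sym.
  apply/ffunP => k; rewrite !ffunE opprD.
  case: (x == i); rewrite !ffunE ?mulr0 ?oppr0 ?addr0 ?add0r; last first.
    by case: ifP; rewrite ?oppr0.
  rewrite addrCA; case: (k == o2); rewrite ?mul1r ?mul0r subrr addr0.
    by case: ifP; rewrite ?oppr0.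
  by case: ifP; rewrite ?oppr0.
apply: (stableD Usub); first by case: ifP.
by rewrite -scaleN1r; apply: (stableZ _ Usub); apply: (Uact _ _ I).
Qed.

End PolynomialCategoryO.

(** * Simplicity *)

Section SimpleAndBlock.
Variable R : realType.
Local Notation P := {mpoly R[i][2]}.
Local Notation pd := (@pd R).
Local Notation xi := (@xi R).
Local Notation Vmod := (@Vmod R).
Local Notation Nmod := (@Nmod R).
Local Notation Imod := (@Imod R).
Local Notation vD := (@vD R).
Local Notation inclN := (@inclN R).
Local Notation inclI := (@inclI R).

Lemma vD0 d i j : vD d i j 0 = 0.
Proof. exact: (linear0 (linear_pack (@vD_linear R d i j))). Qed.

Lemma Nmod_act i j (u : Nmod) k : i != j ->
  inclN (lie_act (Eu R i j) u) k = vD 2 i j (inclN u k) + (k == i)%:R * inclN u j.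
Proof. by move=> ij; rewrite hom_act gl_act_unit // ffunE. Qed.

Lemma Nmod_cartan h (u : Nmod) k : cartan h ->
  inclN (lie_act h u) k =
    \sum_i h i i *: (vD 2 i i (inclN u k) + (k == i)%:R * inclN u i).
Proof.
move=> hc; rewrite hom_act gl_act_cartan // sum_ffunE; apply: eq_bigr => i _.
by rewrite !ffunE.
Qed.

Definition ord23 (k : 'I_2) : 'I_3 := widen_ord (isT : 2 <= 3)%N k.

Lemma Nmod_ext2 (u v : Nmod) :
  (forall l : 'I_2, inclN u (ord23 l) = inclN v (ord23 l)) -> u = v.
Proof.
move=> uv; apply: Nmod_ext; [have := uv i0|have := uv i1].
  by rewrite (_ : ord23 i0 = o0) //; apply: val_inj.
by rewrite (_ : ord23 i1 = o1) //; apply: val_inj.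
Qed.

Lemma Nmod_mk2 (F : 'I_2 -> P) : exists u : Nmod, forall l, inclN u (ord23 l) = F l.
Proof.
have [u [u0 u1]] := Nmod_mk (F i0) (F i1); exists u; case=> [[|[|//]] llt].
  rewrite (_ : ord23 _ = o0); last exact: val_inj.
  by rewrite u0; congr F; apply: val_inj.
rewrite (_ : ord23 _ = o1); last exact: val_inj.
by rewrite u1; congr F; apply: val_inj.
Qed.

Lemma ord3_cases (j : 'I_3) : j = o2 \/ exists l, j = ord23 l.
Proof.
elim/ord3_ind: j; [right; exists i0|right; exists i1|by left]; exact: val_inj.
Qed.

(** The identification of N with pairs of polynomials, in the form required by
    [poly_catO]. *)
Lemma embN_subproof : exists e : 'I_2 -> {linear P -> Nmod}, forall k f l,
  inclN (e k f) (ord23 l) = if l == k then f else 0.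
Proof.
have /choice[e eE] (p : 'I_2 * P) : exists u : Nmod, forall l,
    inclN u (ord23 l) = if l == p.1 then p.2 else 0.
  exact: Nmod_mk2.
have e_lin k : linear (fun f => e (k, f)).
  move=> c f g; apply: Nmod_ext2 => l; rewrite linearP !ffunE !eE /=.
  by case: ifP; rewrite // scaler0 addr0.
by exists (fun k => linear_pack (e_lin k)) => k f l; rewrite eE.
Qed.

Definition embN : 'I_2 -> {linear P -> Nmod} := projT1 (cid embN_subproof).

Lemma embNE k f l : inclN (embN k f) (ord23 l) = if l == k then f else 0.
Proof. exact: (projT2 (cid embN_subproof)). Qed.

Lemma coN_linear (l : 'I_2) : linear (fun u : Nmod => inclN u (ord23 l)).
Proof. by move=> c u v; rewrite linearP !ffunE. Qed.

Definition coN (l : 'I_2) : {linear Nmod -> P} := linear_pack (coN_linear l).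

Lemma embN_span u : u = \sum_k embN k (coN k u).
Proof.
apply: Nmod_ext2 => l; rewrite linear_sum sum_ffunE (bigD1 l) //= embNE eqxx.
by rewrite big1 ?addr0 // => k kl; rewrite embNE eq_sym (negPf kl).
Qed.

Lemma embN_lower k j f :
  embN k (xi j * f) = - lie_act (Eu R o2 (ord23 j)) (embN k f).
Proof.
have o2j : o2 != ord23 j by rewrite -val_eqE neq_ltn (ltn_ord j) orbT.
apply: Nmod_ext2 => l; rewrite linearN ffunE (Nmod_act _ _ o2j).
have -> : (ord23 l == o2) = false by apply/negbTE; rewrite -val_eqE neq_ltn (ltn_ord l).
rewrite mul0r addr0 !embNE; case: (l == k); last by rewrite vD0 oppr0.
case: j {o2j} => [[|[|//]] jlt]; rewrite /vD /opD /opX /opY /= opprK.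
  by congr (xi _ * _); apply: val_inj.
by congr (xi _ * _); apply: val_inj.
Qed.

Lemma embN_weight k m :
  weight_space (\row_j (vwt R 2 m j + (ord23 k == j)%:R)) (embN k 'X_[m]).
Proof.
move=> h hc; apply: Nmod_ext2 => l.
rewrite Nmod_cartan // linearZ !ffunE /weight_eval scaler_suml.
apply: eq_bigr => i _; rewrite mxE [_ * h i i]mulrC -scalerA; congr (_ *: _).
have -> : (ord23 l == i)%:R * inclN (embN k 'X_[m]) i =
          (ord23 l == i)%:R * inclN (embN k 'X_[m]) (ord23 l).
  by have [->|_] := eqVneq (ord23 l) i; rewrite ?mul0r.
rewrite embNE; have [->|_] := eqVneq l k; last by rewrite vD0 mulr0 addr0 scaler0.
by rewrite vD_monomial scalerDl scaler_nat mulr_natl.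
Qed.

Lemma Nmod_catO : in_catO Nmod.
Proof.
apply: (@poly_catO R Nmod 2 embN coN).
- exact: embN_span.
- by move=> k m; eexists; apply: embN_weight.
- move=> n i j u ij un l.
  rewrite -[coN l _]/(inclN _ _) Nmod_act; last by rewrite -val_eqE neq_ltn ij.
  apply: msizeD; first exact: (msize_vD 2 ij (un l)).
  rewrite mulr_natl; apply: msizeMn; have [->|[k ->]] := ord3_cases j; last exact: un.
  rewrite Nmod_third mmeasureN; apply: msizeD.
    rewrite (_ : o0 = ord23 i0); last exact: val_inj.
    exact/msize_pd_le/un.
  rewrite (_ : o1 = ord23 i1); last exact: val_inj.
  exact/msize_pd_le/un.
move=> U Usub U1 k; have [U0 Ulin Uact] := Usub.
apply: (@mpoly_xi_ind R (fun f => U (embN k f))) => [c f g Uf Ug||j f Uf].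
- by rewrite linearP; apply: Ulin.
- exact: U1.
rewrite embN_lower -scaleN1r; apply: (stableZ _ Usub); exact: (Uact _ _ I).
Qed.

Lemma Imod_catO : in_catO Imod.
Proof.
have /short_exactP[_ _ _ C_surj] := exact_V_N_I R.
exact: in_catO_quotient C_surj Nmod_catO.
Qed.

Lemma act_o0o2 d (f : Vmod d) : lie_act (Eu R o0 o2) f = euler (pd i0 f) + pd i0 f *+ d.
Proof. by rewrite gl_act_unit // /vD /opD /opX /opY /= -eulerE. Qed.

Lemma act_o1o2 d (f : Vmod d) : lie_act (Eu R o1 o2) f = euler (pd i1 f) + pd i1 f *+ d.
Proof. by rewrite gl_act_unit // /vD /opD /opX /opY /= -eulerE. Qed.

Lemma act_o0o1 d (f : Vmod d) : lie_act (Eu R o0 o1) f = - (xi i1 * pd i0 f).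
Proof. by rewrite gl_act_unit. Qed.

Lemma act_o1o0 d (f : Vmod d) : lie_act (Eu R o1 o0) f = - (xi i0 * pd i1 f).
Proof. by rewrite gl_act_unit. Qed.

Lemma act_o2o0 d (f : Vmod d) : lie_act (Eu R o2 o0) f = - (xi i0 * f).
Proof. by rewrite gl_act_unit. Qed.

Lemma act_o2o1 d (f : Vmod d) : lie_act (Eu R o2 o1) f = - (xi i1 * f).
Proof. by rewrite gl_act_unit. Qed.

(** E_02 and E_12 lower the degree: a nonzero element of least degree in U is
    killed by both. *)
Lemma Vmod_primitive d (U : set (Vmod d)) (f : Vmod d) :
    submodule U -> U f -> f != 0 ->
  exists g : Vmod d, [/\ U g, g != 0, lie_act (Eu R o0 o2) g = 0 &
    lie_act (Eu R o1 o2) g = 0].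
Proof.
move=> Usub; have [U0 Ulin Uact] := Usub.
have [n] := ubnP (msize (f : P)); elim: n f => // n IH f fn Uf f0.
have lower (x : sl3 R) (g : P) : lie_act x f = g ->
      (msize g < msize (f : P))%N -> g != 0 ->
    exists g : Vmod d, [/\ U g, g != 0, lie_act (Eu R o0 o2) g = 0 &
      lie_act (Eu R o1 o2) g = 0].
  move=> <- gf g0; apply: (IH (lie_act x f)) => //; last exact: (Uact _ _ I).
  exact: leq_trans gf _.
have small j : (msize (euler (pd j f) + pd j f *+ d) < msize (f : P))%N.
  have fs : (0 < msize (f : P))%N by rewrite lt0n msize_poly_eq0.
  rewrite -[X in (_ < X)%N](prednK fs) ltnS.
  apply: msizeD; first exact/msize_euler/msize_pd.
  exact/msizeMn/msize_pd.
have [g0|g0] := eqVneq (lie_act (Eu R o0 o2) f) 0; last first.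
  by apply: (lower _ _ (act_o0o2 f)); rewrite ?small // -act_o0o2.
have [g1|g1] := eqVneq (lie_act (Eu R o1 o2) f) 0; last first.
  by apply: (lower _ _ (act_o1o2 f)); rewrite ?small // -act_o1o2.
by exists f.
Qed.

Lemma Vmod_mul d (U : set (Vmod d)) (f : P) (v : Vmod d) :
  submodule U -> U v -> U (f * v).
Proof.
move=> Usub Uv; have [U0 Ulin Uact] := Usub.
move: f; apply: (@mpoly_xi_ind R (fun f => U (f * v))) => [c f g Uf Ug||j f Uf].
- by rewrite mulrDl -scalerAl; apply: Ulin.
- by rewrite mul1r.
rewrite -mulrA; have [x ->] := @Vmod_lower R d (f * v) j.
exact: (Uact _ _ I).
Qed.

Lemma simple_of_nonzero (M : sl3Module R) (v : M) : v != 0 ->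
    (forall (U : set M) u, submodule U -> U u -> u != 0 -> U = setT) ->
  simple_module M.
Proof.
move=> v0 H; split=> [|U Usub]; first by exists v.
have [[u u0 Uu]|U1] := pselect (exists2 u : M, u != 0 & U u).
  by right; apply: H Uu u0.
left; apply/seteqP; split=> [u Uu|_ ->]; last by case: Usub.
by apply/eqP; apply: contrapT => /negP u0; apply: U1; exists u.
Qed.

(** On V_d with d > 0, the operators E_02 and E_12 are the partial derivatives
    followed by an injective operator. An element killed by both is constant, and
    a nonzero constant generates V_d. *)
Lemma Vmod_simple d : simple_module (Vmod d.+1).
Proof.
apply: (@simple_of_nonzero (Vmod d.+1) (1 : P)); first exact: oner_neq0.
move=> U u Usub Uu u0; have [g [Ug g0]] := Vmod_primitive Usub Uu u0.
rewrite act_o0o2 act_o1o2 => /euler_inj g0' /euler_inj g1'.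
have gE : g = (g@_0%MM)%:MP :> P.
  apply: pd_ker; case=> [[|[|//]] jlt].
    by rewrite (_ : Ordinal jlt = i0) //; apply: val_inj.
  by rewrite (_ : Ordinal jlt = i1) //; apply: val_inj.
have c0 : g@_0%MM != 0 by apply: contra_neq g0 => gc; rewrite gE gc mpolyC0.
apply/seteqP; split=> // f _.
have := Vmod_mul ((g@_0%MM)^-1%:MP * f) Usub Ug.
by rewrite [g in U (_ * g)]gE mulrAC -mpolyCM mulVf // mul1r.
Qed.

(** On V_0, an element killed by E_02 and E_12 has constant partial derivatives.
    Without constant term it is linear, and E_01, E_10 take it to both variables,
    which generate I. *)
Lemma Imod_simple : simple_module Imod.
Proof.
have xiI j : exists a, inclI a = xi j.
  by apply: submod_inclP; rewrite /= -[xi j]mulr1 coef0_xi.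
have [a0 a0E] := xiI i0.
apply: (@simple_of_nonzero _ a0).
  apply/eqP => /(congr1 inclI).
  by rewrite a0E linear0 => /eqP; rewrite (negPf (xi_neq0 _ _)).
move=> U u Usub Uu u0; have Wsub := stable_image inclI Usub.
have [g [[b Ub bg] g0]] : exists g : Vmod 0, [/\ (inclI @` U) g, g != 0,
    lie_act (Eu R o0 o2) g = 0 & lie_act (Eu R o1 o2) g = 0].
  apply: (Vmod_primitive Wsub (f := inclI u)); first by exists u.
  by apply: contra_neq u0; rewrite -(linear0 inclI) => /submod_incl_inj.
rewrite act_o0o2 act_o1o2 !mulr0n !addr0 => /euler_ker g0E /euler_ker g1E.
have [W0 Wlin Wact] := Wsub.
have Wg : (inclI @` U) g by exists b.
have Wxi1 : (inclI @` U) (xi i0 : Vmod 0) -> (inclI @` U) (xi i1 : Vmod 0).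
  move=> /(Wact (Eu R o0 o1) _ I); rewrite act_o0o1 pd_xi mulr1 => W1.
  by rewrite -[xi i1]opprK -scaleN1r; apply: (stableZ _ Wsub).
have Wxi0 : (inclI @` U) (xi i1 : Vmod 0) -> (inclI @` U) (xi i0 : Vmod 0).
  move=> /(Wact (Eu R o1 o0) _ I); rewrite act_o1o0 pd_xi mulr1 => W1.
  by rewrite -[xi i0]opprK -scaleN1r; apply: (stableZ _ Wsub).
have [Wx0 Wx1] : (inclI @` U) (xi i0 : Vmod 0) /\ (inclI @` U) (xi i1 : Vmod 0).
  have [c0|c0] := eqVneq ((pd i0 g)@_0%MM) 0; last first.
    suff W1 : (inclI @` U) (xi i1 : Vmod 0) by split=> //; apply: Wxi0.
    have := Wact (Eu R o0 o1) _ I Wg; rewrite act_o0o1 g0E mulrC mul_mpolyC.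
    move/(stableZ (- ((pd i0 g)@_0%MM)^-1) Wsub).
    by rewrite scalerN scaleNr opprK scalerA mulVf // scale1r.
  have [c1|c1] := eqVneq ((pd i1 g)@_0%MM) 0; last first.
    suff W1 : (inclI @` U) (xi i0 : Vmod 0) by split=> //; apply: Wxi1.
    have := Wact (Eu R o1 o0) _ I Wg; rewrite act_o1o0 g1E mulrC mul_mpolyC.
    move/(stableZ (- ((pd i1 g)@_0%MM)^-1) Wsub).
    by rewrite scalerN scaleNr opprK scalerA mulVf // scale1r.
  case/eqP: g0; rewrite [LHS]pd_ker.
    by rewrite -bg [_@__](submod_incl_mem b) mpolyC0.
  case=> [[|[|//]] jlt].
    by rewrite (_ : Ordinal jlt = i0); [rewrite [LHS]g0E c0 mpolyC0|apply: val_inj].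
  by rewrite (_ : Ordinal jlt = i1); [rewrite [LHS]g1E c1 mpolyC0|apply: val_inj].
apply/seteqP; split=> // a _.
have [f1 [f2 fE]] := aug_decomp (submod_incl_mem a).
have [c Uc] : (inclI @` U) (inclI a).
  rewrite [inclI a]fE; apply: (stableD Wsub); rewrite mulrC.
    exact: (Vmod_mul (d := 0) f1 Wsub Wx0).
  exact: (Vmod_mul (d := 0) f2 Wsub Wx1).
by move=> /submod_incl_inj <-.
Qed.

End SimpleAndBlock.

(** * Non-split sequences and the principal block *)

Section PrincipalBlock.
Variable R : realType.
Local Notation P := {mpoly R[i][2]}.
Local Notation pd := (@pd R).
Local Notation xi := (@xi R).
Local Notation Vmod := (@Vmod R).
Local Notation Mmod := (@Mmod R).
Local Notation Nmod := (@Nmod R).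
Local Notation Imod := (@Imod R).
Local Notation vD := (@vD R).
Local Notation inclN := (@inclN R).
Local Notation inclI := (@inclI R).
Local Notation homX := (@homX R).
Local Notation homY := (@homY R).
Local Notation homC := (@homC R).
Local Notation triv := (trivial_module R).

Lemma coef0_linear : linear (fun f : P => f@_0%MM : R[i]^o).
Proof. by move=> c f g; rewrite mcoeffD mcoeffZ. Qed.

Definition homT : sl3Hom (Vmod 0) triv :=
  @Sl3Hom R (Vmod 0) triv (linear_pack coef0_linear) (@coef0_act0 R).

Lemma exact_I_V_T : short_exact inclI homT.
Proof.
apply/short_exactP; split=> [a|a|m|b].
- by rewrite -(linear0 inclI) => /submod_incl_inj.
- exact: (submod_incl_mem (subU := aug_submodule R)).
- exact: (submod_inclP (aug_submodule R)).
by exists (b%:MP : P); rewrite /= mcoeffC eqxx mulr1.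
Qed.

(** E_20 kills the trivial module, but it acts on V_0 as - xi_0, which is
    injective. *)
Lemma homT_not_split : ~ split_epi homT.
Proof.
move=> /split_epiP[s sK]; have : lie_act (Eu R o2 o0) (s 1) = 0.
  by rewrite -hom_act; apply: linear0.
rewrite act_o2o0 => /eqP; rewrite oppr_eq0 => /eqP/xi_mul_eq0 s1.
have := sK 1; rewrite s1 linear0 => /eqP.
by rewrite eq_sym oner_eq0.
Qed.

Lemma Mmod_act i j (F : Mmod) k : i != j ->
  (lie_act (Eu R i j) F : {ffun 'I_3 -> P}) k = vD 2 i j (F k) + (k == i)%:R * F j.
Proof. by move=> ij; rewrite gl_act_unit // ffunE. Qed.

Lemma vD_o0o2 d f : vD d o0 o2 f = euler (pd i0 f) + pd i0 f *+ d.
Proof. by rewrite eulerE. Qed.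

Lemma vD_o1o2 d f : vD d o1 o2 f = euler (pd i1 f) + pd i1 f *+ d.
Proof. by rewrite eulerE. Qed.

(** A section maps 1 to a triple (f, g, h) killed by E_02 and E_12 with
    d0 f + d1 g + h = 1. Let a, b, c be the constant terms of d0 f, d1 g and h.
    Then 2 a + c = 0 and 2 b + c = 0, against a + b + c = 1. *)
Lemma homX_not_split : ~ split_epi homX.
Proof.
move=> /split_epiP[s sK]; pose m : Mmod := s (1 : P).
have n02 : lie_act (Eu R o0 o2) m = 0.
  by rewrite -hom_act act_o0o2 pd1 linear0 mul0rn addr0 linear0.
have n12 : lie_act (Eu R o1 o2) m = 0.
  by rewrite -hom_act act_o1o2 pd1 linear0 mul0rn addr0 linear0.
have E0 := Mmod_act m o0 (isT : o0 != o2); have E1 := Mmod_act m o1 (isT : o1 != o2).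
have E2 : pd i0 (m o0) + pd i1 (m o1) + m o2 = 1 by rewrite -homXE; apply: sK.
move: E0 E1 E2; rewrite n02 n12 !ffunE vD_o0o2 vD_o1o2 !eqxx !mul1r.
move: (m o0) (m o1) (m o2) => {s sK m n02 n12} f g h.
move=> /esym/(congr1 (mcoeff 0%MM)) E0 /esym/(congr1 (mcoeff 0%MM)) E1.
move=> /(congr1 (mcoeff 0%MM)) E2.
move: E0 E1 E2; rewrite !mcoeffD !coef_euler mdeg0 !mulr0n mcoeff0 mcoeff1.
rewrite eqxx !add0r; move: (pd i0 f)@_0%MM (pd i1 g)@_0%MM h@_0%MM => a b c E0 E1 E2.
have : (a + a + c) + (b + b + c) = 0 by rewrite E0 E1 addr0.
have -> : (a + a + c) + (b + b + c) = (a + b + c) *+ 2 by ring.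
by rewrite E2 => /mulrn_char0/eqP; rewrite oner_eq0.
Qed.

(** In I there is the relation E_21 xi_0 = E_20 xi_1. A section transports it to
    N, where it says that xi_1 times the image of xi_0 is xi_0 times the image of
    xi_1. So both components of the image of xi_0 are divisible by xi_0; its image
    under [homC] then has no linear term in xi_0. *)
Lemma homC_not_split : ~ split_epi homC.
Proof.
move=> /split_epiP[s sK].
have xiI j : exists a, inclI a = xi j.
  by apply: (submod_inclP (aug_submodule R)); rewrite /= -[xi j]mulr1 coef0_xi.
have [a0 a0E] := xiI i0; have [a1 a1E] := xiI i1.
have aE : lie_act (Eu R o2 o1) a0 = lie_act (Eu R o2 o0) a1.
  apply: (@submod_incl_inj _ _ _ (aug_submodule R)); rewrite -!/inclI.
  by rewrite !hom_act a0E a1E act_o2o0 act_o2o1 mulrC.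
have := congr1 s aE; rewrite !hom_act => /(congr1 inclN) E.
have := sK a0; move=> /(congr1 inclI); rewrite homCE a0E.
have lower j (u : Nmod) k : o2 != j -> k != o2 ->
    inclN (lie_act (Eu R o2 j) u) k = vD 2 o2 j (inclN u k).
  by move=> j2 /negPf k2; rewrite (Nmod_act _ _ j2) k2 mul0r addr0.
have Ek k (k2 : k != o2) : vD 2 o2 o1 (inclN (s a0) k) = vD 2 o2 o0 (inclN (s a1) k).
  exact: etrans (esym (lower o1 (s a0) k isT k2))
    (etrans (congr1 (fun F : Mmod => F k) E) (lower o0 (s a1) k isT k2)).
move: (Ek o1 isT) (Ek o0 isT); rewrite /vD /opD /opX /opY /=.
move: (inclN (s a0) o0) (inclN (s a0) o1) (inclN (s a1) o0) (inclN (s a1) o1).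
move=> f0 f1 g0 g1 /oppr_inj E1 /oppr_inj E0 E2.
have g00 : g0@_0%MM = 0.
  have := congr1 (fun f => (pd i0 f)@_0%MM) E0; rewrite !pdM !pd_xi /= !mcoeffD.
  by rewrite !coef0_xi mul0r mul1r mcoeff0 !addr0.
have f10 : f1@_0%MM = 0.
  have := congr1 (fun f => (pd i1 f)@_0%MM) E1; rewrite !pdM !pd_xi /= !mcoeffD.
  by rewrite !coef0_xi mul0r mul1r mcoeff0 !addr0.
have /eqP : xi i0 * (g0 - f1 - 1) = 0.
  by rewrite !mulrBr mulr1 -E0 E2 subrr.
move=> /eqP/xi_mul_eq0/(congr1 (mcoeff 0%MM)) /eqP.
by rewrite !mcoeffB g00 f10 mcoeff1 eqxx mcoeff0 subrr sub0r oppr_eq0 oner_eq0.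
Qed.

Lemma linked_I : linked triv Imod.
Proof.
apply: linked_sym; apply: linked_ext.
- exact: Imod_simple.
- exact: Imod_catO.
- exact: trivial_simple.
- apply: (in_catO_quotient (f := homT)); last exact: Vmod_catO.
  by have /short_exactP[] := exact_I_V_T.
exists (Vmod 0), inclI, homT; split; first exact: Vmod_catO.
  exact: exact_I_V_T.
exact: homT_not_split.
Qed.

Lemma linked_V3 : linked triv (Vmod 3).
Proof.
apply: linked_trans linked_I _; apply: linked_sym; apply: linked_ext.
- exact: Vmod_simple.
- exact: Vmod_catO.
- exact: Imod_simple.
- exact: Imod_catO.
exists Nmod, homY, homC; split; first exact: Nmod_catO.
  exact: exact_V_N_I.
exact: homC_not_split.
Qed.

Lemma linked_in_O0 (L : sl3Module R) : linked triv L -> in_O0 L.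
Proof.
move=> tL; split; first by have [] := linked_right tL.
exact: principal_factors_linked.
Qed.

Definition objV : O0 R := MkO0 (linked_in_O0 linked_V3).
Definition objI : O0 R := MkO0 (linked_in_O0 linked_I).
Definition objVs : O0 R := MkO0 (linked_in_O0 (linked_triv_twist linked_V3)).
Definition objIs : O0 R := MkO0 (linked_in_O0 (linked_triv_twist linked_I)).

Lemma Nmod_O0 : in_O0 Nmod.
Proof.
split; first exact: Nmod_catO.
apply: (principal_factors_ext (exact_V_N_I R)); apply: principal_factors_linked.
  exact: linked_V3.
exact: linked_I.
Qed.

Lemma Mmod_O0 : in_O0 Mmod.
Proof.
split; first exact: Mmod_catO.
apply: (principal_factors_ext (exact_N_M_V R)); first by case: Nmod_O0.
exact: (principal_factors_linked linked_V3).
Qed.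

Definition objN : O0 R := MkO0 Nmod_O0.
Definition objM : O0 R := MkO0 Mmod_O0.

End PrincipalBlock.

(** * Homomorphisms out of modules that are free over the lowering operators *)

Lemma cartan_unit (R : realType) p : cartan (Eu R p p).
Proof.
apply/is_diag_mxP => a b; rewrite EuE; have [->|ap] := eqVneq a p => /=.
  by rewrite val_eqE => /negPf ab; rewrite eq_sym ab mulr0 subr0.
by rewrite val_eqE => /negPf ->; rewrite mulr0 subr0.
Qed.

Section LowerPolynomials.
Variables (R : realType) (W : sl3Module R).
Local Notation P := {mpoly R[i][2]}.
Local Notation xi := (@xi R).

(** The sign makes the lowering operators E_20, E_21 act on the polynomial modules
    as multiplication by the variables. They commute, so they turn every module
    into a module over the polynomial ring. *)
Definition low (j : 'I_2) (w : W) : W := - lie_act (Eu R o2 (ord23 j)) w.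

Lemma low_linear j : linear (low j).
Proof. by move=> c u v; rewrite /low linearP opprD scalerN. Qed.

Lemma low0 j : low j 0 = 0.
Proof. exact: (linear0 (linear_pack (low_linear j))). Qed.

Lemma low_comm w : low i1 (low i0 w) = low i0 (low i1 w).
Proof.
rewrite /low !linearN !opprK /= unit_act.
by rewrite -!val_eqE /= !scale0r subrr addr0.
Qed.

Definition low_mon (u : W) (m : 'X_{1..2}) : W :=
  iter (m i0) (low i0) (iter (m i1) (low i1) u).

Lemma low_mon_xi u j m : low_mon u (U_(j) + m)%MM = low j (low_mon u m).
Proof.
rewrite /low_mon !mnmDE !mnm1E; case: j => [[|[|//]] jlt].
  have -> : Ordinal jlt = i0 by apply: val_inj.
  by rewrite /= add0n.
have -> : Ordinal jlt = i1 by apply: val_inj.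
rewrite /= add0n; elim: (m i0) => //= n ->.
exact/esym/low_comm.
Qed.

Definition low_poly (u : W) (f : P) : W :=
  \sum_(m <- msupp f) f@_m *: low_mon u m.

(** The sum over a fixed finite set of monomials makes linearity in f visible. *)
Lemma low_polyE u f k : (msize f <= k)%N ->
  low_poly u f = \sum_(m : 'X_{1..2 < k}) f@_m *: low_mon u m.
Proof.
move=> fk; pose I : subFinType _ := 'X_{1..2 < k}.
rewrite /low_poly (big_mksub I) //=; first last.
- by move=> x /msize_mdeg_lt /leq_trans; apply.
- by rewrite msupp_uniq.
by rewrite big_rmcond //= => i; move/memN_msupp_eq0 ->; rewrite scale0r.
Qed.

Lemma low_poly_linear u : linear (low_poly u).
Proof.
move=> c f g; pose k := maxn (msize f) (msize g).
have fk : (msize f <= k)%N by rewrite leq_maxl.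
have gk : (msize g <= k)%N by rewrite leq_maxr.
have fgk : (msize (c *: f + g) <= k)%N.
  by apply: msizeD => //; apply: leq_trans (msizeZ_le _ _) _.
rewrite (low_polyE u fk) (low_polyE u gk) (low_polyE u fgk) scaler_sumr -big_split.
by apply: eq_bigr => m _; rewrite mcoeffD mcoeffZ scalerDl scalerA.
Qed.

Lemma low_poly0 u : low_poly u 0 = 0.
Proof. exact: (linear0 (linear_pack (low_poly_linear u))). Qed.

Lemma low_polyX u m : low_poly u 'X_[m] = low_mon u m.
Proof. by rewrite /low_poly msuppX big_seq1 mcoeffX eqxx scale1r. Qed.

Lemma low_poly1 u : low_poly u 1 = u.
Proof. by rewrite -mpolyX0 low_polyX /low_mon !mnm0E. Qed.

Lemma low_poly_xi u j f : low_poly u (xi j * f) = low j (low_poly u f).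
Proof.
elim/mpoly_lin_ind: f => [c f g Ef Eg||m].
- by rewrite mulrDr -scalerAr !low_poly_linear low_linear Ef Eg.
- by rewrite mulr0 low_poly0 low0.
by rewrite xiE -mpolyXD !low_polyX low_mon_xi.
Qed.

End LowerPolynomials.

(** Here X is free over the polynomial ring with basis [emb i 1], i < k. It is the
    module induced from the parabolic subalgebra, so a homomorphism out of X is
    given by the images of the basis, and these have to satisfy the same relations
    as the basis under the Cartan subalgebra and under the remaining matrix units
    E_pq with p < 2. *)
Section UniversalProperty.
Variables (R : realType) (X W : sl3Module R) (k : nat).
Local Notation P := {mpoly R[i][2]}.
Local Notation xi := (@xi R).
Variables (emb : 'I_k -> {linear P -> X}) (co : 'I_k -> {linear X -> P}).
Hypothesis X_span : forall w, w = \sum_i emb i (co i w).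
Hypothesis co_emb : forall i l f, co i (emb l f) = if i == l then f else 0.
Hypothesis emb_lower : forall i j f, emb i (xi j * f) = low j (emb i f).

Lemma hom_unique (f g : sl3Hom X W) :
  (forall i, f (emb i 1) = g (emb i 1)) -> f =1 g.
Proof.
move=> fg1; have fg i p : f (emb i p) = g (emb i p).
  elim/mpoly_xi_ind: p => [c p q Ep Eq||j p Ep]; first by rewrite !linearP Ep Eq.
    exact: fg1.
  by rewrite emb_lower /low !linearN !hom_act Ep.
by move=> w; rewrite (X_span w) !linear_sum; apply: eq_bigr => i _.
Qed.

Variables (u : 'I_k -> W) (lam : 'I_k -> weight R).
Hypothesis wt_emb : forall i, weight_space (lam i) (emb i 1).
Hypothesis wt_u : forall i, weight_space (lam i) (u i).

Definition ext_map (w : X) : W := \sum_i low_poly (u i) (co i w).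

Lemma ext_map_linear : linear ext_map.
Proof.
move=> c v w; rewrite /ext_map scaler_sumr -big_split; apply: eq_bigr => i _.
by rewrite linearP low_poly_linear.
Qed.

Lemma ext_map_emb i f : ext_map (emb i f) = low_poly (u i) f.
Proof.
rewrite /ext_map (bigD1 i) //= co_emb eqxx big1 ?addr0 // => l li.
rewrite co_emb (negPf li).
exact: low_poly0.
Qed.

Lemma ext_map_low j w : ext_map (low j w) = low j (ext_map w).
Proof.
have e_sum (F : 'I_k -> X) : ext_map (\sum_i F i) = \sum_i ext_map (F i).
  exact: (linear_sum (linear_pack ext_map_linear)).
have l_sum (V : sl3Module R) (F : 'I_k -> V) : low j (\sum_i F i) = \sum_i low j (F i).
  exact: (linear_sum (linear_pack (@low_linear R V j))).
rewrite (X_span w) l_sum !e_sum l_sum; apply: eq_bigr => i _.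
by rewrite -emb_lower !ext_map_emb low_poly_xi.
Qed.

Hypothesis gen_act : forall i (p q : 'I_3), p != q -> p != o2 ->
  ext_map (lie_act (Eu R p q) (emb i 1)) = lie_act (Eu R p q) (u i).

(** By induction on the degree: [y, E_2j] is again an element of sl3, so the
    induction step needs the claim for all y at once. *)
Lemma ext_map_act x w : ext_map (lie_act x w) = lie_act x (ext_map w).
Proof.
have eZ c v : ext_map (c *: v) = c *: ext_map v.
  exact: (linearZ_LR (linear_pack ext_map_linear)).
have e_sum (F : 'I_k -> X) : ext_map (\sum_i F i) = \sum_i ext_map (F i).
  exact: (linear_sum (linear_pack ext_map_linear)).
have e_sum3 (F : 'I_3 -> X) : ext_map (\sum_i F i) = \sum_i ext_map (F i).
  exact: (linear_sum (linear_pack ext_map_linear)).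
have gen i y : ext_map (lie_act y (emb i 1)) = lie_act y (u i).
  rewrite !(lie_act_units y) e_sum3; apply: eq_bigr => p _.
  rewrite e_sum3; apply: eq_bigr => q _; rewrite eZ; congr (_ *: _).
  have [<-|pq] := eqVneq p q.
    have cp := @cartan_unit R p.
    by rewrite wt_emb // wt_u // eZ ext_map_emb low_poly1.
  have [p2|] := eqVneq p o2; last exact: gen_act.
  have [l ql] : exists l, q = ord23 l.
    by case: (ord3_cases q) => // q2; rewrite p2 q2 eqxx in pq.
  have := ext_map_low l (emb i 1); rewrite /low ext_map_emb low_poly1 p2 ql.
  by rewrite -scaleN1r eZ scaleN1r => /oppr_inj.
have eB v v' : ext_map (v - v') = ext_map v - ext_map v'.
  exact: (linearB (linear_pack ext_map_linear)).
have act_low (V : sl3Module R) j y (v : V) : lie_act y (low j v) =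
    low j (lie_act y v) - lie_act (sl3_bracket y (Eu R o2 (ord23 j))) v.
  by rewrite /low linearN lie_act_bracket opprB addKr.
have emb_act i f : forall y,
    ext_map (lie_act y (emb i f)) = lie_act y (ext_map (emb i f)).
  elim/mpoly_xi_ind: f => [c f g Ef Eg|y|j f Ef] => [y||y].
  - by rewrite !linearP !ext_map_linear !linearP Ef Eg.
  - by rewrite gen ext_map_emb low_poly1.
  by rewrite emb_lower act_low eB !ext_map_low Ef act_low Ef.
rewrite (X_span w) linear_sum !e_sum linear_sum; apply: eq_bigr => i _.
exact: emb_act.
Qed.

Definition ext_hom : sl3Hom X W :=
  @Sl3Hom R X W (linear_pack ext_map_linear) ext_map_act.

Lemma ext_homE i : ext_hom (emb i 1) = u i.
Proof. by rewrite [LHS]ext_map_emb low_poly1. Qed.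

End UniversalProperty.

(** * Weights of the simple modules *)

Section Weights.
Variable R : realType.
Local Notation P := {mpoly R[i][2]}.
Local Notation xi := (@xi R).
Local Notation Vmod := (@Vmod R).
Local Notation Imod := (@Imod R).
Local Notation vD := (@vD R).
Local Notation inclI := (@inclI R).

Lemma weight_eval_unit (lam : weight R) i :
  weight_eval lam (Eu R i i) = lam 0 i - (\sum_j lam 0 j) / 3.
Proof.
rewrite /weight_eval (eq_bigr (fun j => lam 0 j * (j == i)%:R - lam 0 j / 3)).
  rewrite sumrB -mulr_suml (bigD1 i) //= eqxx mulr1 big1 ?addr0 // => j /negPf ->.
  by rewrite mulr0.
by move=> j _; rewrite EuE !eqxx andbb mulr1 mulrBr mul1r.
Qed.

(** Rows that differ by a multiple of (1, 1, 1) are the same weight of sl3. *)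
Lemma weight_space_shift (M : sl3Module R) (lam mu : weight R) (v : M) :
  (forall i j, lam 0 i - mu 0 i = lam 0 j - mu 0 j) ->
  weight_space lam v -> weight_space mu v.
Proof.
move=> lm vlam h hc; rewrite vlam //; congr (_ *: _); apply/eqP; rewrite -subr_eq0.
rewrite /weight_eval -sumrB (eq_bigr (fun i => (lam 0 o0 - mu 0 o0) * h i i)).
  by rewrite -mulr_sumr sl3_tr mulr0.
by move=> i _; rewrite -mulrBl (lm i o0).
Qed.

Lemma Vmod_weight d lam (f : Vmod d) m : weight_space lam f -> f@_m != 0 ->
  forall p q, vwt R d m p - lam 0 p = vwt R d m q - lam 0 q.
Proof.
move=> flam fm; have avg p : vwt R d m p - lam 0 p = (\sum_i (vwt R d m i - lam 0 i)) / 3.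
  have := congr1 (mcoeff m) (flam _ (@cartan_unit R p)).
  rewrite gl_act_cartan; last exact: cartan_unit.
  rewrite linear_sum mcoeffZ weight_eval_unit.
  have -> : \sum_i (Eu R p p i i *: vD d i i f)@_m =
      (vwt R d m p - (\sum_i vwt R d m i) / 3) * f@_m.
    rewrite (eq_bigr (fun i => (vwt R d m i * (i == p)%:R - vwt R d m i / 3) * f@_m)).
      rewrite -mulr_suml sumrB -mulr_suml (bigD1 p) //= eqxx mulr1 big1 ?addr0 //.
      by move=> j /negPf ->; rewrite mulr0.
    move=> i _; rewrite mcoeffZ vD_coef mulrA EuE !eqxx andbb mulr1; congr (_ * _).
    by rewrite mulrC mulrBr mul1r.
  move/(mulIf fm) => E; rewrite sumrB mulrBl.
  move: E; move: (\sum_i vwt R d m i) (\sum_i lam 0 i) => x y E.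
  have -> : vwt R d m p = lam 0 p - y / 3 + x / 3 by rewrite -E subrK.
  by ring.
by move=> p q; rewrite (avg p) (avg q).
Qed.

Definition wt (a b c : int) : weight R :=
  \row_i (match val i with 0 => a | 1 => b | _ => c end)%:~R.

Lemma wt_act (M : sl3Module R) (i j : 'I_3) a b c (v : M) :
  weight_space (wt a b c) v ->
  weight_space (wt (a + (i == o0)%:Z - (j == o0)%:Z)
    (b + (i == o1)%:Z - (j == o1)%:Z) (c + (i == o2)%:Z - (j == o2)%:Z))
    (lie_act (Eu R i j) v).
Proof.
move=> /(weight_space_act i j); congr weight_space; apply/rowP.
by elim/ord3_ind; rewrite !mxE /= rmorphB rmorphD /= !(eq_sym _ i) !(eq_sym _ j).
Qed.

Lemma Vmod_wt d a b c (f : Vmod d) m : weight_space (wt a b c) f -> f@_m != 0 ->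
  a - b = (m i1)%:Z - (m i0)%:Z /\
  b - c = - (m i1)%:Z - (m i0)%:Z - (m i1)%:Z - d%:Z.
Proof.
move=> fw fm; have E := Vmod_weight fw fm.
have mE : mdeg m = (m i0 + m i1)%N.
  by rewrite mdegE big_ord_recl big_ord1; congr (_ + m _)%N; apply: val_inj.
move: (E o0 o1) (E o1 o2); rewrite !mxE /vwt /= mE => E1 E2.
split; apply: (@intr_inj R[i]).
  rewrite !rmorphB /= -!pmulrn; apply/eqP; rewrite -subr_eq0; apply/eqP.
  by move/esym/eqP: E1; rewrite -subr_eq0 => /eqP <-; ring.
rewrite !rmorphB rmorphN /= -!pmulrn; apply/eqP; rewrite -subr_eq0; apply/eqP.
by move/esym/eqP: E2; rewrite -subr_eq0 !natrD => /eqP <-; ring.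
Qed.

Lemma sigma_wtE a b c : sigma_wt (wt a b c) = wt (- c) (- b) (- a).
Proof. by apply/rowP; elim/ord3_ind; rewrite !mxE /= rmorphN. Qed.

Local Notation V3s := (twist (Vmod 3)).

Lemma V3s_wt a b c (f : V3s) m : weight_space (wt a b c) f -> (f : P)@_m != 0 ->
  b - c = (m i1)%:Z - (m i0)%:Z /\
  a - b = - (m i1)%:Z - (m i0)%:Z - (m i1)%:Z - 3.
Proof.
move=> /weight_space_twist; rewrite sigma_wtE => fw fm.
by have [E1 E2] := Vmod_wt fw fm; split; lia.
Qed.

(** The weight (a, b, c) does not occur in the twist of V_3; k and l are the
    exponents of a monomial. *)
Definition V3s_free a b c := forall k l : nat, b - c = k%:Z - l%:Z ->
  a - b = - k%:Z - l%:Z - k%:Z - 3 -> False.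

(** As [V3s_free], for I; the constant monomial is missing from I. *)
Definition I_free a b c := forall k l : nat, (0 < k + l)%N -> a - b = k%:Z - l%:Z ->
  b - c = - k%:Z - l%:Z - k%:Z -> False.

Lemma V3s_wt0 a b c (f : V3s) : V3s_free a b c -> weight_space (wt a b c) f -> f = 0.
Proof.
move=> free fw; apply: (@mpoly_eq0 R) => m; apply/eqP; apply: contrapT => /negP fm.
by have [E1 E2] := V3s_wt fw fm; apply: (free (m i1) (m i0)).
Qed.

Lemma I_wt a b c (f : Imod) m : weight_space (wt a b c) f -> (inclI f)@_m != 0 ->
  [/\ (0 < m i1 + m i0)%N, a - b = (m i1)%:Z - (m i0)%:Z &
  b - c = - (m i1)%:Z - (m i0)%:Z - (m i1)%:Z].
Proof.
move=> fw fm; have [E1 E2] := Vmod_wt (weight_space_hom inclI fw) fm.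
split=> //; last by lia.
rewrite lt0n; apply: contraNneq fm => m0; have -> : m = 0%MM.
  apply/eqP; rewrite -mdeg_eq0 mdegE big_ord_recl big_ord1.
  by rewrite (_ : lift _ _ = i1) ?[(_ + m i1)%N]addnC ?m0 //; apply: val_inj.
by apply/eqP; apply: (submod_incl_mem f).
Qed.

Lemma I_wt0 a b c (f : Imod) : I_free a b c -> weight_space (wt a b c) f -> f = 0.
Proof.
move=> free fw; apply: (@submod_incl_inj _ _ _ (aug_submodule R)).
rewrite linear0; apply: (@mpoly_eq0 R) => m; apply/eqP; apply: contrapT => /negP fm.
by have [E0 E1 E2] := I_wt fw fm; apply: (free (m i1) (m i0)).
Qed.

Lemma monomial_single (f : P) (n : 'X_{1..2}) :
  (forall m, f@_m != 0 -> m = n) -> f = f@_n *: 'X_[n].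
Proof.
move=> fn; apply/mpolyP => m; rewrite mcoeffZ mcoeffX; have [<-|nm] := eqVneq n m.
  by rewrite mulr1.
by rewrite mulr0; apply/eqP; apply: contraNT nm => /fn ->.
Qed.

Lemma mnm2P (m n : 'X_{1..2}) : m i0 = n i0 -> m i1 = n i1 -> m = n.
Proof.
move=> mn0 mn1; apply/mnmP; case=> [[|[|//]] jlt].
  by rewrite (_ : Ordinal jlt = i0) //; apply: val_inj.
by rewrite (_ : Ordinal jlt = i1) //; apply: val_inj.
Qed.

Lemma I_wt_xi0 (f : Imod) : weight_space (wt (- 1) 0 1) f ->
  exists c, inclI f = c *: xi i0.
Proof.
move=> fw; exists ((inclI f)@_U_(i0)); rewrite xiE; apply: monomial_single => m fm.
have [m0 E1 E2] := I_wt fw fm; apply: mnm2P; rewrite mnm1E /=; lia.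
Qed.

Lemma I_wt_xi0sq (f : Imod) : weight_space (wt (- 2) 0 2) f ->
  exists c, inclI f = c *: (xi i0 * xi i0).
Proof.
move=> fw; exists ((inclI f)@_(U_(i0) + U_(i0))); rewrite xiE -mpolyXD.
apply: monomial_single => m fm.
have [m0 E1 E2] := I_wt fw fm; apply: mnm2P; rewrite mnmDE mnm1E /=; lia.
Qed.

End Weights.

(** * Universal properties of the generalized Verma modules *)

Section Uniserial.
Variable R : realType.
Local Notation P := {mpoly R[i][2]}.
Local Notation pd := (@pd R).
Local Notation xi := (@xi R).
Local Notation Vmod := (@Vmod R).
Local Notation Nmod := (@Nmod R).
Local Notation vD := (@vD R).

Definition embV d (i : 'I_1) : {linear P -> Vmod d} := idfun.
Definition coV d (i : 'I_1) : {linear Vmod d -> P} := idfun.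

Lemma embV_lower d i j f : embV d i (xi j * f) = low j (embV d i f).
Proof.
rewrite -[RHS]/(- lie_act (Eu R o2 (ord23 j)) (f : Vmod d)) -[LHS]/(xi j * f).
case: j => [[|[|//]] jlt].
  have -> : ord23 (Ordinal jlt) = o0 by apply: val_inj.
  by rewrite act_o2o0 opprK; congr (xi _ * _); apply: val_inj.
have -> : ord23 (Ordinal jlt) = o1 by apply: val_inj.
by rewrite act_o2o1 opprK; congr (xi _ * _); apply: val_inj.
Qed.

Lemma embV_span d w : w = \sum_i embV d i (coV d i w).
Proof. by rewrite big_ord1. Qed.

Lemma coV_embV d i l f : coV d i (embV d l f) = if i == l then f else 0.
Proof. by rewrite !ord1. Qed.

Lemma Vmod_hom_unique d (W : sl3Module R) (f g : sl3Hom (Vmod d) W) :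
  f (1 : P) = g (1 : P) -> f =1 g.
Proof.
by move=> fg; apply: (hom_unique (@embV_span d) (@embV_lower d)).
Qed.

Lemma Nmod_hom_unique (W : sl3Module R) (f g : sl3Hom Nmod W) :
  (forall k, f (embN R k 1) = g (embN R k 1)) -> f =1 g.
Proof. exact: (hom_unique (@embN_span R) (@embN_lower R)). Qed.

Lemma one_weight : @weight_space R (Vmod 3) (wt R (- 1) (- 1) 2) (1 : P).
Proof.
have w0 : @weight_space R (Vmod 3) (\row_i vwt R 3 0%MM i) ('X_[0%MM] : P).
  by apply: gl_weight => i; rewrite vD_monomial mxE.
rewrite -mpolyX0; apply: weight_space_shift w0.
by elim/ord3_ind; elim/ord3_ind; rewrite !mxE /vwt /= ?mnm0E ?mdeg0 ?rmorphN /=; ring.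
Qed.

Lemma V3_universal (W : sl3Module R) (v : W) :
    lie_act (Eu R o0 o1) v = 0 -> lie_act (Eu R o1 o0) v = 0 ->
    lie_act (Eu R o0 o2) v = 0 -> lie_act (Eu R o1 o2) v = 0 ->
    weight_space (wt R (- 1) (- 1) 2) v ->
  exists h : sl3Hom (Vmod 3) W, h (1 : P) = v.
Proof.
move=> v01 v10 v02 v12 vw.
have w1 := one_weight.
have gen (i : 'I_1) (p q : 'I_3) : p != q -> p != o2 ->
    ext_map (coV 3) (fun=> v) (lie_act (Eu R p q) (embV 3 i 1)) = lie_act (Eu R p q) v.
  have e0 : ext_map (coV 3) (fun=> v) 0 = 0.
    exact: (linear0 (linear_pack (ext_map_linear (coV 3) (fun=> v)))).
  rewrite -[embV 3 i 1]/(1 : Vmod 3).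
  elim/ord3_ind: p; elim/ord3_ind: q => // _ _.
  - by rewrite v01 act_o0o1 pd1 mulr0 oppr0.
  - by rewrite v02 act_o0o2 pd1 linear0 mul0rn addr0.
  - by rewrite v10 act_o1o0 pd1 mulr0 oppr0.
  - by rewrite v12 act_o1o2 pd1 linear0 mul0rn addr0.
pose h := ext_hom (@embV_span 3) (@coV_embV 3) (@embV_lower 3)
  (lam := fun=> wt R (- 1) (- 1) 2) (fun=> w1) (fun=> vw) gen.
by exists h; apply: (ext_homE _ _ _ _ _ _ ord0).
Qed.

Lemma embN_act k (p q : 'I_3) : p != q -> p != o2 ->
  lie_act (Eu R p q) (embN R k 1) =
  if q == ord23 k then embN R (if p == o0 then i0 else i1) 1 else 0.
Proof.
move=> pq p2; apply: Nmod_ext2 => l; rewrite (Nmod_act _ _ pq) embNE.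
have -> : vD 2 p q (if l == k then 1 else 0) = 0.
  case: ifP => _; last exact: vD0.
  case: (ord3_cases p) => [p2'|[a ->]]; first by rewrite p2' eqxx in p2.
  rewrite /vD /opD; have -> : opX (pd i0) (pd i1) (ord23 a) 1 = 0.
    by case: a => [[|[|//]] alt]; rewrite /opX /= pd1.
  exact: (linear0 (linear_pack (@opY_linear _ _ _ _ _ _ 2 q))).
rewrite add0r.
have [->|qk] := eqVneq q (ord23 k).
  rewrite !embNE eqxx mulr1.
  case: (ord3_cases p) => [p2'|[a ->]]; first by rewrite p2' eqxx in p2.
  case: a => [[|[|//]] alt]; case: l => [[|[|//]] llt]; by rewrite -!val_eqE.
rewrite linear0 ffunE.
case: (ord3_cases q) => [q2|[a qa]].
  rewrite q2 Nmod_third (_ : o0 = ord23 i0); last exact: val_inj.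
  rewrite (_ : o1 = ord23 i1); last exact: val_inj.
  rewrite !embNE; case: ifP => _; case: ifP => _;
    by rewrite ?pd1 ?linear0 addr0 oppr0 mulr0.
rewrite qa embNE; have -> : (a == k) = false.
  by apply/negbTE; apply: contra_neqN qk => /eqP <-.
by rewrite mulr0.
Qed.

(** N is induced from the two-dimensional representation of the Levi factor
    spanned by u0 and u1. *)
Lemma N_universal (W : sl3Module R) (u0 u1 : W) :
    lie_act (Eu R o0 o1) u1 = u0 -> lie_act (Eu R o1 o0) u0 = u1 ->
    lie_act (Eu R o0 o1) u0 = 0 -> lie_act (Eu R o1 o0) u1 = 0 ->
    lie_act (Eu R o0 o2) u0 = 0 -> lie_act (Eu R o1 o2) u0 = 0 ->
    lie_act (Eu R o0 o2) u1 = 0 -> lie_act (Eu R o1 o2) u1 = 0 ->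
    weight_space (wt R 0 (- 1) 1) u0 -> weight_space (wt R (- 1) 0 1) u1 ->
  exists h : sl3Hom Nmod W, h (embN R i0 1) = u0 /\ h (embN R i1 1) = u1.
Proof.
move=> a011 a100 a010 a101 a020 a120 a021 a121 w0 w1.
pose u (k : 'I_2) := if k == i0 then u0 else u1.
pose lam (k : 'I_2) := if k == i0 then wt R 0 (- 1) 1 else wt R (- 1) 0 1.
have wu k : weight_space (lam k) (u k) by rewrite /lam /u; case: ifP.
have wn k : weight_space (lam k) (embN R k 1).
  have := @embN_weight R k 0%MM; rewrite mpolyX0; apply: weight_space_shift.
  rewrite /lam; case: k => [[|[|//]] klt]; elim/ord3_ind; elim/ord3_ind;
  by rewrite !mxE /vwt -!val_eqE /= ?mnm0E ?mdeg0 ?rmorphN /=; ring.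
have coE : forall i l f, coN R i (embN R l f) = if i == l then f else 0.
  by move=> i l f; rewrite -embNE.
have gen (i : 'I_2) (p q : 'I_3) : p != q -> p != o2 ->
    ext_map (coN R) u (lie_act (Eu R p q) (embN R i 1)) = lie_act (Eu R p q) (u i).
  move=> pq p2; rewrite embN_act //.
  have e0 : ext_map (coN R) u 0 = 0.
    exact: (linear0 (linear_pack (@ext_map_linear R Nmod W 2 (coN R) u))).
  have eN k : ext_map (coN R) u (embN R k 1) = u k.
    by rewrite (ext_map_emb coE) low_poly1.
  case: i => [[|[|//]] ilt]; move: pq p2; rewrite /u -!val_eqE /=;
  elim/ord3_ind: p; elim/ord3_ind: q => //= _ _;
  by rewrite ?e0 ?eN /u -?val_eqE /= ?a011 ?a100 ?a010 ?a101 ?a020 ?a120 ?a021 ?a121.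
pose h := ext_hom (@embN_span R) coE (@embN_lower R) wn wu gen.
by exists h; split; rewrite ext_homE.
Qed.

End Uniserial.

(** * No module has layers ST, T, ST *)

Lemma weight_space0 (R : realType) (M : sl3Module R) lam :
  weight_space lam (0 : M).
Proof. by move=> h hc; rewrite linear0 scaler0. Qed.

Lemma weight_space_lin (R : realType) (M : sl3Module R) lam c (x y : M) :
  weight_space lam x -> weight_space lam y -> weight_space lam (c *: x + y).
Proof.
move=> xw yw h hc; rewrite (lie_act_linearr h c x y) (xw h hc) (yw h hc).
by rewrite scalerDr !scalerA [c * _]mulrC.
Qed.

Section Core.
Variable R : realType.
Local Notation P := {mpoly R[i][2]}.
Local Notation xi := (@xi R).
Local Notation Vmod := (@Vmod R).
Local Notation Nmod := (@Nmod R).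
Local Notation Imod := (@Imod R).
Local Notation inclI := (@inclI R).
Local Notation homY := (@homY R).
Local Notation homC := (@homC R).

Local Notation V3s := (twist (Vmod 3)).
Local Notation wt := (wt R).
Local Notation Eu := (Eu R).

(** M is spanned by weight vectors, and only vectors of weight (-2, 1, 1) contribute
    to the constant term of the image. *)
Lemma V3s_lift (M : sl3Module R) (p : sl3Hom M V3s) :
    in_catO M -> (forall b, exists m, p m = b) ->
  exists v, weight_space (wt (- 2) 1 1) v /\ p v = (1 : P).
Proof.
move=> [_ /seteqP[_ Mss] _] p_surj; have [m pm] := p_surj (1 : P).
pose Z := [set m : M | exists v, weight_space (wt (- 2) 1 1) v /\
   (p m : P)@_0%MM = (p v : P)@_0%MM].
have Zm : Z m.
  apply: (smallest_sub _ _ (Mss m I)).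
    split=> [|c x y [x' [xw xx]] [y' [yw yy]]|//].
      by exists 0; split=> //; apply: weight_space0.
    exists (c *: x' + y'); split; first exact: weight_space_lin.
    have pc a b : (p (c *: a + b) : P)@_0%MM = c * (p a : P)@_0%MM + (p b : P)@_0%MM.
      by rewrite linearP; apply: coef0_linear.
    by rewrite !pc xx yy.
  move=> x [mu _ xmu].
  have [c0|c0] := eqVneq ((p x : P)@_0%MM) 0.
    exists 0; split; first exact: weight_space0.
    by rewrite c0 linear0 mcoeff0.
  have /weight_space_twist pw := weight_space_hom p xmu.
  exists x; split=> //; apply: weight_space_shift xmu => i j.
  have := Vmod_weight pw c0 (rev_ord i) (rev_ord j).
  rewrite !mxE !rev_ordK => /eqP; rewrite -subr_eq0 => /eqP E.
  apply/eqP; rewrite -subr_eq0 -[X in _ == X]E; apply/eqP; move: {E} (mu 0 i) (mu 0 j).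
  elim/ord3_ind: i; elim/ord3_ind: j => a b;
  by rewrite /vwt /= ?mnm0E ?mdeg0 ?rmorphN /=; ring.
have [v [vw pv]] := Zm; exists v; split=> //.
have pvw := weight_space_hom p vw.
rewrite [LHS](@monomial_single R (p v) 0%MM).
  by rewrite -pv pm mcoeff1 eqxx scale1r mpolyX0.
move=> n fn; have [E1 E2] := V3s_wt pvw fn.
by apply: mnm2P; rewrite mnm0E; lia.
Qed.

Section NoUniserial.
Variables (M N : sl3Module R) (jN : sl3Hom N M) (p : sl3Hom M V3s).
Variables (t : sl3Hom V3s N) (r : sl3Hom N Imod).
Hypotheses (M_catO : in_catO M) (jp : short_exact jN p) (tr : short_exact t r).
Hypotheses (p_nsplit : ~ split_epi p) (r_nsplit : ~ split_epi r).

Let jN_inj : forall a, jN a = 0 -> a = 0. Proof. by case/short_exactP: jp. Qed.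
Let p_ker : forall m, p m = 0 -> exists a, jN a = m. Proof. by case/short_exactP: jp. Qed.
Let p_surj : forall b, exists m, p m = b. Proof. by case/short_exactP: jp. Qed.
Let t_inj : forall a, t a = 0 -> a = 0. Proof. by case/short_exactP: tr. Qed.
Let r_ker : forall m, r m = 0 -> exists a, t a = m. Proof. by case/short_exactP: tr. Qed.
Let ker_r_wt0 a b c (n : N) :
  V3s_free a b c -> weight_space (wt a b c) n -> r n = 0 -> n = 0.
Proof.
move=> free nw /r_ker[x xn]; rewrite -xn in nw *.
by rewrite (V3s_wt0 free (weight_space_inj t_inj nw)) linear0.
Qed.

Let N_wt0 a b c (n : N) :
  V3s_free a b c -> I_free a b c -> weight_space (wt a b c) n -> n = 0.
Proof.
move=> Vfree Ifree nw; apply: (ker_r_wt0 Vfree nw).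
exact: (I_wt0 Ifree (weight_space_hom r nw)).
Qed.

Let M_lift a b c (m : M) : V3s_free a b c -> weight_space (wt a b c) m ->
  exists n, jN n = m /\ weight_space (wt a b c) n.
Proof.
move=> free mw; have /p_ker[n nm] : p m = 0.
  by apply: (V3s_wt0 free (weight_space_hom p mw)).
by exists n; split=> //; apply: (weight_space_inj jN_inj); rewrite nm.
Qed.

Let M_wt0 a b c (m : M) :
  V3s_free a b c -> I_free a b c -> weight_space (wt a b c) m -> m = 0.
Proof.
move=> Vfree Ifree mw; have [n [<- nw]] := M_lift Vfree mw.
by rewrite (N_wt0 Vfree Ifree nw) linear0.
Qed.

(** After a twist by [sigma], the vanishing conditions are those of
    [V3_universal], so v is the image of 1 under a section of p. *)
Let top_not_singular (v : M) : weight_space (wt (- 2) 1 1) v -> p v = (1 : P) ->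
  lie_act (Eu o0 o1) v = 0 -> lie_act (Eu o1 o2) v = 0 -> lie_act (Eu o0 o2) v = 0 ->
  lie_act (Eu o2 o1) v = 0 -> False.
Proof.
move=> vw pv v01 v12 v02 v21; apply: p_nsplit.
have r0 : rev_ord o0 = o2 by apply: val_inj.
have r1 : rev_ord o1 = o1 by apply: val_inj.
have r2 : rev_ord o2 = o0 by apply: val_inj.
have act i j : @lie_act R (twist M) (Eu i j) v = - lie_act (Eu (rev_ord j) (rev_ord i)) v.
  by rewrite /= sigma_unit lie_actNl.
have [h hv] : exists h : sl3Hom (Vmod 3) (twist M), h (1 : P) = v.
  apply: V3_universal; rewrite ?act ?r0 ?r1 ?r2 ?v01 ?v12 ?v02 ?v21 ?oppr0 //.
  by apply/weight_space_twist; rewrite sigma_wtE.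
apply/split_epiP; exists (twist_coadjoint h).
pose ph := untwist_hom (sl3Hom_comp p (twist_coadjoint h)).
apply: (@Vmod_hom_unique R 3 (Vmod 3) ph (sl3Hom_id _)).
by rewrite [LHS](congr1 p hv).
Qed.

(** By [N_universal] there is a homomorphism from the polynomial module [Nmod] to N
    that maps a generator to w. It lifts [homC], and it kills the submodule V_3 of
    [Nmod] because the weight (-1, -1, 2) does not occur in the kernel of r. So
    it induces a section of r. *)
Let kernel_not_generated (w : N) : weight_space (wt (- 1) 0 1) w ->
  inclI (r w) = - xi i0 -> lie_act (Eu o1 o0) w = 0 -> False.
Proof.
move=> ww rw w10; apply: r_nsplit.
have n01 : lie_act (Eu o0 o1) (lie_act (Eu o0 o1) w) = 0.
  by apply: (@N_wt0 1 (- 2) 1); [..|exact: (wt_act o0 o1 (wt_act o0 o1 ww))];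
    move=> k l; lia.
have w0w : weight_space (wt 0 (- 1) 1) (lie_act (Eu o0 o1) w).
  exact: (wt_act o0 o1 ww).
have Ew (lam : weight R) (x : N) i : weight_space lam x ->
    lie_act (Eu i i) x = weight_eval lam (Eu i i) *: x.
  by move=> xw; apply: xw; apply: cartan_unit.
have u010 : lie_act (Eu o1 o0) (lie_act (Eu o0 o1) w) = w.
  rewrite unit_act w10 linear0 add0r !eqxx !scale1r !(Ew _ _ _ ww) -scalerBl.
  rewrite !weight_eval_unit !mxE /= rmorphN /=.
  by rewrite -[RHS]scale1r; congr (_ *: _); ring.
have [h [h0 h1]] : exists h : sl3Hom Nmod N,
    h (embN R i0 1) = lie_act (Eu o0 o1) w /\ h (embN R i1 1) = w.
  apply: N_universal => //.
  - by apply: (@N_wt0 1 (- 1) 0); [..|exact: (wt_act o0 o2 w0w)]; move=> k l; lia.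
  - by apply: (@N_wt0 0 0 0); [..|exact: (wt_act o1 o2 w0w)]; move=> k l; lia.
  - by apply: (@N_wt0 0 0 0); [..|exact: (wt_act o0 o2 ww)]; move=> k l; lia.
  - by apply: (@N_wt0 (- 1) 1 0); [..|exact: (wt_act o1 o2 ww)]; move=> k l; lia.
have rh : forall x, r (h x) = homC x.
  apply: (@Nmod_hom_unique R Imod (sl3Hom_comp r h) homC) => k.
  apply: (@submod_incl_inj _ _ _ (aug_submodule R)); rewrite -!/inclI homCE.
  rewrite (_ : o0 = ord23 i0); last exact: val_inj.
  rewrite (_ : o1 = ord23 i1); last exact: val_inj.
  rewrite !embNE; case: k => [[|[|//]] klt].
    rewrite (_ : Ordinal klt = i0); last exact: val_inj.
    rewrite [LHS](congr1 (fun x => inclI (r x)) h0) !hom_act rw act_o0o1.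
    by rewrite linearN /= pd_xi mulrN opprK mulr0 subr0.
  rewrite (_ : Ordinal klt = i1); last exact: val_inj.
  by rewrite [LHS](congr1 (fun x => inclI (r x)) h1) rw /= mulr0 sub0r mulr1.
have hY : forall g, h (homY g) = 0.
  move=> g; apply/eqP; apply: contrapT => /negP hg.
  have := @simple_ker R (Vmod 3) N (sl3Hom_comp h homY) g (Vmod_simple R 2) hg (1 : P).
  suff h10 : h (homY (1 : P)) = 0 by move=> /(_ h10)/eqP; rewrite oner_eq0.
  have [_ CY _ _] := (short_exactP _ _).1 (exact_V_N_I R).
  apply: (@ker_r_wt0 (- 1) (- 1) 2); [by move=> k l; lia| |by rewrite rh CY].
  apply/weight_space_hom/weight_space_hom.
  exact: one_weight.
have [_ _ C_ker C_surj] := (short_exactP _ _).1 (exact_V_N_I R).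
have [s sE] : exists s : sl3Hom Imod N, forall x, s (homC x) = h x.
  apply: hom_factor => // x /C_ker[g <-]; exact: hY.
apply/split_epiP; exists s => b; have [x <-] := C_surj b.
by rewrite sE rh.
Qed.

Lemma no_uniserial_model : False.
Proof.
have [v [vw pv]] := V3s_lift M_catO p_surj.
have v12 : lie_act (Eu o1 o2) v = 0.
  by apply: (@M_wt0 (- 2) 2 0); [..|exact: (wt_act o1 o2 vw)]; move=> k l; lia.
have v02 : lie_act (Eu o0 o2) v = 0.
  by apply: (@M_wt0 (- 1) 1 0); [..|exact: (wt_act o0 o2 vw)]; move=> k l; lia.
have wfree : V3s_free (- 1) 0 1 by move=> k l; lia.
have yfree : V3s_free (- 2) 0 2 by move=> k l; lia.
have [w [wE ww]] := M_lift wfree (wt_act o0 o1 vw : weight_space (wt (- 1) 0 1) _).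
have [y [yE yw]] := M_lift yfree (wt_act o2 o1 vw : weight_space (wt (- 2) 0 2) _).
have [c rw] := I_wt_xi0 (weight_space_hom r ww).
have [d ry] := I_wt_xi0sq (weight_space_hom r yw).
have yw_rel : lie_act (Eu o0 o1) y = lie_act (Eu o2 o1) w.
  apply/subr0_eq/jN_inj; rewrite linearB !hom_act yE wE unit_act.
  by rewrite -!val_eqE /= !scale0r subrr addr0 subrr.
(* On xi_0 ^ 2 and xi_0, the operators E_01 and E_21 give - 2 xi_0 xi_1 and
   - xi_0 xi_1. *)
have cd : c = d *+ 2.
  have := congr1 (fun x => inclI (r x)) yw_rel.
  rewrite !hom_act rw ry act_o0o1 act_o2o1 !linearZ /= pdM pd_xi mul1r mulr1.
  rewrite -!mul_mpolyC => /oppr_inj/(mulfI (xi_neq0 R i1)) E.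
  have : (d%:MP *+ 2 - c%:MP) * xi i0 = 0 by rewrite mulrBl -E; ring.
  rewrite mulrC => /xi_mul_eq0/(congr1 (mcoeff 0%MM)).
  rewrite mcoeff0 mcoeffB mcoeffMn !mcoeffC eqxx !mulr1 => /eqP.
  by rewrite subr_eq0 => /eqP.
(* By the previous step the left side lies in the kernel of r, where its weight
   does not occur. *)
have yq : y *+ 2 + lie_act (Eu o2 o0) w = 0.
  apply: (ker_r_wt0 yfree).
    have qw : weight_space (wt (- 2) 0 2) (lie_act (Eu o2 o0) w) := wt_act o2 o0 ww.
    by rewrite -scaler_nat; apply: weight_space_lin.
  apply: (@submod_incl_inj _ _ _ (aug_submodule R)); rewrite -!/inclI.
  rewrite !linearD !linear0 !hom_act rw ry act_o2o0 cd.
  by rewrite -!mul_mpolyC mpolyCMn; ring.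
(* E_12 E_21 v is E_21 E_12 v = 0 plus (E_11 - E_22) v, and the weight
   (-2, 1, 1) vanishes on E_11 - E_22. *)
have y12 : lie_act (Eu o1 o2) y = 0.
  apply: jN_inj; rewrite hom_act yE unit_act v12 linear0 add0r !eqxx !scale1r.
  rewrite !(vw _ (@cartan_unit R _)) -scalerBl !weight_eval_unit !mxE /=.
  by rewrite subrr scale0r.
have w12 : lie_act (Eu o1 o2) w = 0.
  by apply: (@N_wt0 (- 1) 1 0); [..|exact: (wt_act o1 o2 ww)]; move=> k l; lia.
have w10 : lie_act (Eu o1 o0) w = 0.
  have := congr1 (lie_act (Eu o1 o2)) yq; rewrite mulr2n !linearD /= y12 !add0r.
  by rewrite unit_act w12 !linear0 add0r eqxx scale1r -!val_eqE /= scale0r subr0.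
have [c0|c0] := eqVneq c 0.
  have d0 : d = 0 by move: cd; rewrite c0 => /esym/mulrn_char0.
  have w0 : w = 0.
    apply: (ker_r_wt0 wfree ww); apply: (@submod_incl_inj _ _ _ (aug_submodule R)).
    by rewrite -!/inclI rw c0 scale0r linear0.
  have y0 : y = 0.
    apply: (ker_r_wt0 yfree yw); apply: (@submod_incl_inj _ _ _ (aug_submodule R)).
    by rewrite -!/inclI ry d0 scale0r linear0.
  by apply: (top_not_singular vw pv); rewrite // -?wE -?yE ?w0 ?y0 linear0.
apply: (@kernel_not_generated (- c^-1 *: w)).
- by rewrite -[_ *: w]addr0; apply: weight_space_lin => //; apply: weight_space0.
- have -> : inclI (r (- c^-1 *: w)) = - c^-1 *: inclI (r w) by rewrite !linearZ.
  by rewrite rw scalerA mulNr mulVf // scaleN1r.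
- by rewrite linearZ /= w10 scaler0.
Qed.

End NoUniserial.

End Core.

(** * Functors on the block *)

Section Recognition.
Variable R : realType.
Local Notation Imod := (@Imod R).
Local Notation V3s := (twist (Vmod R 3)).
Local Notation xi := (@xi R).

Lemma mod_iso_trans (A B C : sl3Module R) : mod_iso A B -> mod_iso B C -> mod_iso A C.
Proof.
by case=> f fbij [g gbij]; exists (sl3Hom_comp g f); apply: bij_comp.
Qed.

Lemma short_exact_iso (A A' N B B' : sl3Module R) (f : sl3Hom A N) (g : sl3Hom N B)
    (a : sl3Hom A' A) (b : sl3Hom B B') : bijective a -> bijective b ->
  short_exact f g -> short_exact (sl3Hom_comp f a) (sl3Hom_comp b g).
Proof.
move=> abij bbij /short_exactP[f_inj gf g_ker g_surj].
have [a' aK a'K] := abij; have [b' bK b'K] := bbij.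
apply/short_exactP; split=> [x /f_inj ax|x /=|n /= bgn|y].
- by apply: (bij_inj abij); rewrite ax linear0.
- by rewrite gf linear0.
- have [|x <-] := g_ker n; first by apply: (bij_inj bbij); rewrite bgn linear0.
  by exists (a' x); rewrite /= a'K.
by have [n ny] := g_surj (b' y); exists n; rewrite /= ny b'K.
Qed.

Lemma split_epi_iso (N B B' : sl3Module R) (g : sl3Hom N B) (b : sl3Hom B B') :
  bijective b -> split_epi (sl3Hom_comp b g) -> split_epi g.
Proof.
move=> bbij /split_epiP[s sK]; apply/split_epiP; exists (sl3Hom_comp s b) => x.
by apply: (bij_inj bbij); rewrite [LHS](sK (b x)).
Qed.

Lemma no_uniserial (A B C M N : sl3Module R) (j : sl3Hom N M) (p : sl3Hom M C)
    (f : sl3Hom A N) (g : sl3Hom N B) :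
    in_catO M -> short_exact j p -> short_exact f g ->
    ~ split_epi p -> ~ split_epi g ->
  mod_iso A V3s -> mod_iso B Imod -> mod_iso C V3s -> False.
Proof.
move=> MO jp fg p_nsplit g_nsplit /mod_iso_sym[a abij] [b bbij] [c cbij].
have idbij (L : sl3Module R) : bijective (sl3Hom_id L) by exists id.
apply: (no_uniserial_model MO (short_exact_iso (idbij _) cbij jp)
  (short_exact_iso abij bbij fg)).
  by move/(split_epi_iso cbij).
by move/(split_epi_iso bbij).
Qed.

(** F applied to a section of F g is a section of F (F g), which is isomorphic
    to g. *)
Lemma split_epi_reflect (F : O0Functor R) (M N : O0 R) (g : sl3Hom M N) :
  involutive_functor F -> split_epi (fmor F g) -> split_epi g.
Proof.
move=> [eta [eta_bij eta_nat]] [s gs]; have [eN' [_ eN'K]] := hom_inverse (eta_bij N).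
apply/split_epiP; exists (sl3Hom_comp (eta M) (sl3Hom_comp (fmor F s) eN')) => x /=.
have := congr1 (fun h : sl3Hom (F (F M)) N => h (fmor F s (eN' x))) (eta_nat _ _ g).
rewrite /= => <-.
have := congr1 (fun h : sl3Hom (F (F N)) (F (F N)) => h (eN' x))
  (fmor_comp F (fmor F g) s).
by rewrite gs fmor_id /= => <-; rewrite eN'K.
Qed.

Lemma sum3 (V : nmodType) (F : 'I_3 -> V) (Q : pred 'I_3) :
  \sum_(i < 3 | Q i) F i = (if Q o0 then F o0 else 0) + (if Q o1 then F o1 else 0) +
    (if Q o2 then F o2 else 0).
Proof.
rewrite big_mkcond !big_ord_recl big_ord0 /= addr0 addrA.
have <- : ord0 = o0 by apply: val_inj.
have <- : lift ord0 ord0 = o1 by apply: val_inj.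
by have <- : lift ord0 (lift ord0 ord0) = o2 by apply: val_inj.
Qed.

Lemma rhoE i : rho R 0 i = 1 - (i : nat)%:R.
Proof.
rewrite /rho.
have -> : \sum_(i < 3) \sum_(j < 3 | (i < j)%N) (eps R i - eps R j) =
    (eps R o0 - eps R o1) + (eps R o0 - eps R o2) + (eps R o1 - eps R o2).
  by rewrite !sum3 /= !addr0 ?add0r.
by rewrite !mxE -!val_eqE; elim/ord3_ind: i => /=; field.
Qed.

Lemma dot0E x i : dot0 R x 0 i = (i : nat)%:R - (x i : nat)%:R.
Proof.
have -> : dot0 R x 0 i = rho R 0 (x i) - rho R 0 i.
  by rewrite /dot0 /weyl_act mxE [col_perm _ _ _ _]mxE [(- rho R) _ _]mxE.
by rewrite !rhoE; ring.
Qed.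

Lemma dot0_wt (x : 'S_3) (a b c : 'I_3) : x o0 = a -> x o1 = b -> x o2 = c ->
  dot0 R x = wt R (- (a : nat)%:Z) (1 - (b : nat)%:Z) (2 - (c : nat)%:Z).
Proof.
move=> xa xb xc; apply/rowP; elim/ord3_ind; rewrite dot0E ?xa ?xb ?xc mxE /=.
- by rewrite sub0r rmorphN.
- by rewrite rmorphB.
- by rewrite rmorphB.
Qed.

Lemma nplus_kill (M : sl3Module R) (v : M) :
    (forall i j : 'I_3, (i < j)%N -> lie_act (Eu R i j) v = 0) ->
  forall x, nplus x -> lie_act x v = 0.
Proof.
move=> vE x xn; rewrite lie_act_units big1 // => i _; rewrite big1 // => j _.
have [ji|ij] := leqP j i; first by rewrite xn // scale0r.
by rewrite vE // scaler0.
Qed.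

Lemma hw_V : highest_weight_vector (wt R (- 1) (- 1) 2) (1 : Vmod R 3).
Proof.
split; [exact: oner_neq0|exact: one_weight|apply: nplus_kill].
elim/ord3_ind; elim/ord3_ind => // _.
- by rewrite act_o0o1 pd1 mulr0 oppr0.
- by rewrite act_o0o2 pd1 linear0 mul0rn addr0.
- by rewrite act_o1o2 pd1 linear0 mul0rn addr0.
Qed.

Lemma hw_I : exists v : Imod, highest_weight_vector (wt R 0 (- 1) 1) v.
Proof.
have [v vE] : exists v, inclI R v = xi ord_max.
  by apply: (submod_inclP (aug_submodule R)); rewrite /= -[xi _]mulr1 coef0_xi.
have I0 u : inclI R u = 0 -> u = 0.
  by rewrite -(linear0 (inclI R)) => /submod_incl_inj.
exists v; split.
- apply/eqP => /(congr1 (inclI R)).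
  by rewrite vE linear0 => /eqP; rewrite (negPf (xi_neq0 _ _)).
- apply: (weight_space_inj I0); rewrite vE xiE.
  have w0 : @weight_space R (Vmod R 0)
      (\row_i vwt R 0 U_(ord_max)%MM i) ('X_ord_max : {mpoly R[i][2]}).
    by apply: gl_weight => i; rewrite vD_monomial mxE.
  apply: weight_space_shift w0.
  by elim/ord3_ind; elim/ord3_ind; rewrite !mxE /vwt /= ?mnm1E ?mdeg1 ?rmorphN /=; ring.
apply: nplus_kill; elim/ord3_ind; elim/ord3_ind => // _; apply: I0; rewrite hom_act vE.
- by rewrite act_o0o1 pd_xi mulr0 oppr0.
- by rewrite act_o0o2 pd_xi linear0 mul0rn addr0.
- by rewrite act_o1o2 pd_xi eulerE !pd1 !mulr0 !addr0.
Qed.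

Lemma hw_twist (M : sl3Module R) a b c (v : M) :
  highest_weight_vector (wt R a b c) v ->
  @highest_weight_vector R (twist M) (wt R (- c) (- b) (- a)) v.
Proof.
case=> v0 vw vn; split=> // [|x /sigma_nplus/vn //].
by apply/weight_space_twist; rewrite sigma_wtE !opprK.
Qed.

Lemma is_L_V (x : 'S_3) : x o0 = o1 -> x o1 = o2 -> x o2 = o0 -> is_L x (Vmod R 3).
Proof.
move=> x0 x1 x2; split; first exact: Vmod_simple.
by exists (1 : {mpoly R[i][2]}); rewrite (dot0_wt x0 x1 x2); apply: hw_V.
Qed.

Lemma is_L_Vs (x : 'S_3) : x o0 = o2 -> x o1 = o0 -> x o2 = o1 -> is_L x V3s.
Proof.
move=> x0 x1 x2; split; first exact/simple_twist/Vmod_simple.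
exists (1 : {mpoly R[i][2]}); rewrite (dot0_wt x0 x1 x2).
exact: (hw_twist hw_V).
Qed.

Lemma is_L_I (x : 'S_3) : x o0 = o0 -> x o1 = o2 -> x o2 = o1 -> is_L x Imod.
Proof.
move=> x0 x1 x2; split; first exact: Imod_simple.
by have [v vh] := hw_I; exists v; rewrite (dot0_wt x0 x1 x2).
Qed.

Lemma is_L_Is (x : 'S_3) : x o0 = o1 -> x o1 = o0 -> x o2 = o2 -> is_L x (twist Imod).
Proof.
move=> x0 x1 x2; split; first exact/simple_twist/Imod_simple.
have [v vh] := hw_I; exists v; rewrite (dot0_wt x0 x1 x2).
exact: (hw_twist vh).
Qed.

End Recognition.

Theorem mainTheorem11 (R : realType) :
  (~ exists F : O0Functor R,
      [/\ is_equivalence F, exact_functor F, involutive_functor F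
        & forall (x : 'S_3) (L L' : O0 R),
            is_L x L -> is_L (x^-1)%g L' -> mod_iso (F L) L'])
  /\
  (~ exists F : O0Functor R,
      [/\ is_equivalence F, exact_functor F, involutive_functor F
        & forall (x : 'S_3) (L L' : O0 R),
            is_L (x * w0)%g L -> is_L (x^-1 * w0)%g L' -> mod_iso (F L) L']).
Proof.
have t01 : [/\ tperm o0 o1 o0 = o1, tperm o0 o1 o1 = o0 & tperm o0 o1 o2 = o2].
  by split; rewrite ?tpermL ?tpermR ?tpermD.
have t12 : [/\ tperm o1 o2 o0 = o0, tperm o1 o2 o1 = o2 & tperm o1 o2 o2 = o1].
  by split; rewrite ?tpermL ?tpermR ?tpermD.
have [[t010 t011 t012] [t120 t121 t122]] := (t01, t12).
have tE := (t010, t011, t012, t120, t121, t122).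
have w00 : w0 o0 = o2 by rewrite permE; apply: val_inj.
have w01 : w0 o1 = o1 by rewrite permE; apply: val_inj.
have w02 : w0 o2 = o0 by rewrite permE; apply: val_inj.
have wE := (w00, w01, w02).
pose jN : sl3Hom (objN R) (objM R) := inclN R.
pose pX : sl3Hom (objM R) (objV R) := homX R.
pose tY : sl3Hom (objV R) (objN R) := homY R.
pose rC : sl3Hom (objN R) (objI R) := homC R.
have nsplitX (F : O0Functor R) : involutive_functor F -> ~ split_epi (fmor F pX).
  by move=> F_inv /(split_epi_reflect F_inv)/homX_not_split.
have nsplitC (F : O0Functor R) : involutive_functor F -> ~ split_epi (fmor F rC).
  by move=> F_inv /(split_epi_reflect F_inv)/homC_not_split.
split=> -[F [_ F_exact F_inv FL]].
- have FV : mod_iso (F (objV R)) (twist (Vmod R 3)).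
    apply: (FL (tperm o1 o2 * tperm o0 o1)%g (objV R) (objVs R)).
      by apply: is_L_V; rewrite permM !tE.
    by apply: is_L_Vs; rewrite invMg !tpermV permM !tE.
  have FI : mod_iso (F (objI R)) (Imod R).
    apply: (FL (tperm o1 o2) (objI R) (objI R)).
      by apply: is_L_I; rewrite tE.
    by apply: is_L_I; rewrite tpermV tE.
  exact: (no_uniserial (O0P (F (objM R))).1 (F_exact _ _ _ jN pX (exact_N_M_V R))
    (F_exact _ _ _ tY rC (exact_V_N_I R)) (nsplitX F F_inv) (nsplitC F F_inv) FV FI FV).
have FV : mod_iso (F (objV R)) (Vmod R 3).
  apply: (FL (tperm o0 o1) (objV R) (objV R)).
    by apply: is_L_V; rewrite permM !tE !wE.
  by apply: is_L_V; rewrite tpermV permM !tE !wE.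
have FI : mod_iso (F (objI R)) (twist (Imod R)).
  apply: (FL (tperm o0 o1 * tperm o1 o2)%g (objI R) (objIs R)).
    by apply: is_L_I; rewrite !permM !tE !wE.
  by apply: is_L_Is; rewrite invMg !tpermV !permM !tE !wE.
have sFV := mod_iso_twist FV.
have sFI := mod_iso_trans (mod_iso_twist FI) (mod_iso_twistK (Imod R)).
apply: (no_uniserial (in_catO_twist (O0P (F (objM R))).1)
  (short_exact_twist (F_exact _ _ _ jN pX (exact_N_M_V R)))
  (short_exact_twist (F_exact _ _ _ tY rC (exact_V_N_I R))) _ _ sFV sFI sFV).
  by move/split_epi_twist/(nsplitX F F_inv).
by move/split_epi_twist/(nsplitC F F_inv).
Qed.
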